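(* A minimal graph story $\mathcal{S}=(G,5,\tau)$ is $1$-reroute realizable if and only if $G$ does not contain $K_5$ as a subgraph.
   Context: A graph story is a tuple $\mathcal{S}=(G,\omega,k,\tau)$ where $G=(V,E)$ is an $n$-vertex graph, $\omega\le n$ is a positive integer, $k\ge 0$ is an integer, and $\tau=\langle v_1,\dots,v_n\rangle$ is a linear ordering of $V$; a minimal graph story is one with $k=0$, written $(G,\omega,\tau)$. For $1\le i\le n$, $G_i$ is the subgraph of $G$ induced by $\{v_j:\max\{1,i-\omega+1\}\le j\le i\}$. Throughout, every edge $(v_i,v_j)$ of $G$ satisfies $|i-j|<\omega$. A drawing maps vertices to distinct points of the plane and edges to Jordan arcs between their end-vertices; it is planar if no two edges intersect except at common endpoints. Given a planar drawing $\Gamma$ of a graph, an edge $(u,v)$ incident to two distinct faces $f$ and $f'$ of $\Gamma$, and a point $p$ inside $f$, rerouting $(u,v)$ with respect to $p$ means planarly redrawing the edge $(u,v)$, keeping the positions of $u$ and $v$ (and the rest of the drawing), so that $p$ lies inside $f'$. For $h\ge 0$, an $h$-reroute realization of $\mathcal{S}$ on a set $P$ of $\omega+k$ points is a sequence $\langle\Gamma_1,\dots,\Gamma_n\rangle$ such that each $\Gamma_i$ is a planar drawing of $G_i$ with distinct vertices mapped to distinct points of $P$, and for $2\le i\le n$ the restriction of $\Gamma_i$ to $G_{i-1}\cap G_i$ is obtained from the restriction of $\Gamma_{i-1}$ to $G_{i-1}\cap G_i$ by rerouting at most $h$ distinct edges with respect to $h$ points of $P$. $\mathcal{S}$ is $h$-reroute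 realizable if it has an $h$-reroute realization on some set of $\omega+k$ points. *)

(* Defs.v *)
(* MathComp / MathComp-Analysis *)
From HB Require Import structures.
From mathcomp Require Import all_boot all_order all_algebra.

Set Implicit Arguments.
Unset Strict Implicit.
Unset Printing Implicit Defensive.

Record sgraph := SGraph {
  vertex :> finType;
  edges : {set {set vertex}};
  card_edge : forall e, e \in edges -> #|e| = 2 }.

Definition has_complete_subgraph (m : nat) (G : sgraph) : Prop :=
  exists f : 'I_m -> G,
    injective f /\ forall i j, i != j -> [set f i; f j] \in edges G.

Definition induced_edges (G : sgraph) (W : {set G}) : {set {set G}} :=
  [set e in edges G | e \subset W].

Definition on_common_cycle (G : sgraph) (W : {set G}) (e c : {set G}) : Prop :=
  exists s : seq G,
    [/\ 2 < size s, uniq s,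
        cycle (fun x y => [set x; y] \in induced_edges W) s,
        exists2 x, x \in s & e = [set x; next s x]
      & exists2 x, x \in s & c = [set x; next s x]].

(* 1-based: the vertices of [:: v_1; ...; v_n] have positions 1, ..., n. *)
Definition position (T : eqType) (tau : seq T) (v : T) : nat :=
  (index v tau).+1.

Record graph_story := GraphStory {
  story_graph : sgraph;
  story_window : nat;
  story_extra : nat;
  story_order : seq story_graph;
  story_window_gt0 : 0 < story_window;
  story_window_le : story_window <= #|story_graph|;
  story_order_uniq : uniq story_order;
  story_order_total : forall v : story_graph, v \in story_order;
  story_edge_short : forall u v : story_graph,
    [set u; v] \in edges story_graph ->
    position story_order u < position story_order v + story_window }.

Definition minimal_story (S : graph_story) : Prop := story_extra S = 0.

(* V(G_i).  The G_i and the intersections of G_(i-1) and G_i are all induced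
   subgraphs of G, so below a subgraph is given by its vertex set W. *)
Definition visible (S : graph_story) (i : nat) : {set story_graph S} :=
  [set v | position (story_order S) v <= i
           & i < position (story_order S) v + story_window S].

From mathcomp Require Import boolp classical_sets functions cardinality reals.
From mathcomp Require Import topology normedtype.
Import numFieldNormedType.Exports.
Import Order.TTheory GRing.Theory Num.Theory.
Local Open Scope ring_scope.
Local Open Scope classical_set_scope.

Notation plane R := (R * R)%type.

Definition jordan_arc (R : realType) (a b : plane R) (A : set (plane R)) : Prop :=
  exists g : R -> plane R,
    [/\ {within `[0, 1], continuous g}, {in `[0, 1] &, injective g},
        g 0 = a, g 1 = b & A = g @` `[0, 1]].

(* One type of drawings for all subgraphs of G: as a drawing of the subgraph
   induced by W, only the values on W and on [induced_edges W] matter. *)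
Record drawing (R : realType) (G : sgraph) := Drawing {
  place : G -> plane R;
  curve : {set G} -> set (plane R) }.

(* The third clause is the usual convention that an edge does not pass through
   a vertex that is not one of its ends; it only adds something for isolated
   vertices. *)
Definition planar_drawing (R : realType) (G : sgraph) (W : {set G})
    (D : drawing R G) : Prop :=
  [/\ {in W &, injective (place D)},
      forall u v, [set u; v]%SET \in induced_edges W ->
        jordan_arc (place D u) (place D v) (curve D [set u; v]%SET),
      forall e w, e \in induced_edges W -> w \in W ->
        curve D e (place D w) -> w \in e
    & forall e e', e \in induced_edges W -> e' \in induced_edges W -> e != e' ->
        forall z, curve D e z -> curve D e' z ->
        exists2 w, (w \in e) && (w \in e') & z = place D w].

Definition same_drawing (R : realType) (G : sgraph) (W : {set G})
    (D D' : drawing R G) : Prop :=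
  {in W, place D =1 place D'} /\ {in induced_edges W, curve D =1 curve D'}.

Definition drawn_set (R : realType) (G : sgraph) (W : {set G})
    (D : drawing R G) : set (plane R) :=
  [set z | (exists2 w, w \in W & z = place D w) \/
           (exists2 e, e \in induced_edges W & curve D e z)].

Definition face (R : realType) (G : sgraph) (W : {set G}) (D : drawing R G)
    (f : set (plane R)) : Prop :=
  exists2 z, ~ drawn_set W D z & f = connected_component (~` drawn_set W D) z.

Definition incident (R : realType) (G : sgraph) (D : drawing R G)
    (e : {set G}) (f : set (plane R)) : Prop :=
  curve D e `<=` closure f.

(* Redrawing e changes its incident faces as point sets.  The face f of D,
   incident to e, persists as the face g of the new drawing that lies on the
   same side as f of an unchanged edge c, where c is on the boundary of f and on
   a cycle through e.  If e is incident to two distinct faces, then e lies on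
   a cycle all of whose edges are incident to f, so such c exist; all of them,
   and all inner points z of c, determine the same g, namely the face on the same side
   of the directed edge e as f. *)
Definition same_face (R : realType) (G : sgraph) (W : {set G})
    (D : drawing R G) (e : {set G}) (f g : set (plane R)) : Prop :=
  exists c z,
    [/\ c != e, on_common_cycle W e c, incident D c f,
        curve D c z /\ (forall w, w \in c -> z <> place D w)
      & \forall y \near z, f y <-> g y].

Definition reroute (R : realType) (G : sgraph) (W : {set G})
    (D D' : drawing R G) (e : {set G}) (p : plane R) : Prop :=
  [/\ e \in induced_edges W,
      planar_drawing W D',
      {in W, place D =1 place D'},
      (forall c, c \in induced_edges W -> c != e -> curve D c = curve D' c)
    & exists f f' g',
        [/\ [/\ face W D f, face W D f' & f <> f'],
            incident D e f /\ incident D e f',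
            f p,
            face W D' g' /\ same_face W D e f' g'
          & g' p]].

Fixpoint reroutes (R : realType) (G : sgraph) (W : {set G})
    (P : set (plane R)) (es : seq {set G}) (D D' : drawing R G) : Prop :=
  if es is e :: es' then
    exists D1 p, [/\ P p, reroute W D D1 e p & reroutes W P es' D1 D']
  else same_drawing W D D'.

Definition reroute_realization (R : realType) (h : nat) (S : graph_story)
    (P : set (plane R)) (D : nat -> drawing R (story_graph S)) : Prop :=
  (forall i, (1 <= i <= #|story_graph S|)%N ->
     planar_drawing (visible S i) (D i) /\
     forall v, v \in visible S i -> P (place (D i) v)) /\
  (forall i, (2 <= i <= #|story_graph S|)%N ->
     exists es, [/\ uniq es, (size es <= h)%N
       & reroutes (visible S i.-1 :&: visible S i)%SET P es (D i.-1) (D i)]).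

Definition reroute_realizable (R : realType) (h : nat) (S : graph_story) : Prop :=
  exists (P : set (plane R)) (D : nat -> drawing R (story_graph S)),
    (P #= `I_(story_window S + story_extra S))%card /\ reroute_realization h P D.

(* Main.v *)
(* If G contains K5, its five vertices lie in one window, and a planar drawing
   of that window is impossible by van Kampen's parity argument: sampling the
   arcs finely enough, crossing numbers modulo 2 can be counted combinatorially.

   For the converse the drawings have to be constructed, and infinitely many
   isotopy classes of drawings are unavoidable.  All of them are images, under
   homeomorphisms of the plane, of one straight-line drawing of K5 minus an
   edge: a triangle (the equator) and two poles, one inside and one outside,
   that are not joined to each other.  Vertex v_i is always placed at the point
   number i mod 5.  Replacing an edge of the equator by one that joins the poles
   (a flip) yields, up to a homeomorphism, again the straight-line drawing; this
   only takes an explicit homeomorphism for each of the three equatorial edges.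
   When a new vertex x takes the place of a removed one and is joined to the
   opposite pole a, one flips an equatorial edge that is not in G, if there is
   one.  Otherwise two successive flips, at the edge zw and at xy, where y, z, w
   are the equatorial vertices, amount to rerouting zw with respect to the
   position of x, and the missing edge is moved to xy, and if necessary by a
   further flip to another edge that is not in G. *)
Require Import Defs.
From mathcomp Require Import all_boot all_order all_algebra fingroup perm.
From mathcomp Require Import boolp classical_sets functions cardinality reals.
From mathcomp Require Import topology normedtype.
From mathcomp Require Import zify ring lra.
Import numFieldNormedType.Exports.
Import Order.TTheory GRing.Theory Num.Theory.
Set Implicit Arguments.
Unset Strict Implicit.
Unset Printing Implicit Defensive.
Local Open Scope ring_scope.
Local Open Scope classical_set_scope.

(** * Parity of crossings *)

(** Nonplanarity: for disjoint arcs [g1], [g2] the difference [g2 t - g1 s] maps a square into the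
    plane without 0, so along the boundary of the square it has winding number zero. Read modulo 2
    at the upper half of the vertical axis, this is one equation per pair of independent edges,
    where each term that depends on an arc involves one edge and one vertex. No general position of
    the arcs is needed. Realization: a reroute is specified through faces, so the faces of
    arbitrarily bent drawings must be known. In a state every triangle of arcs is the homeomorphic
    image of a straight one, whose two sides are given by signs of barycentric coordinates; this
    stands in for the Jordan curve theorem. The states before and after a reroute have different
    charts and are compared through common arcs only: a face is determined by its boundary and one
    point on the other side ([divides_unique]). Since edges may be absent, a face of the drawing can
    contain several canonical faces; it is bounded from outside by triangles known to be drawn and
    filled from inside across arcs that are not drawn. *)

Section Parity.
Variable R : realType.
Implicit Types x y z w : plane R.

(* The sign of a vector in the lexicographic order, so that exactly one of x and
   -x is ahead when x <> 0. *)
Definition ahead x : bool := (0 < x.1) || ((x.1 == 0) && (0 < x.2)).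
Definition above x : bool := 0 < x.2.
(* Meaningful only for nearby points: it tells whether the segment from x to y
   crosses the upper half of the vertical axis. *)
Definition crossing x y : bool := above x && (ahead x (+) ahead y).

Lemma aheadN x : x <> 0 -> ahead (- x) = ~~ ahead x.
Proof.
case: x => a b xN; rewrite /ahead /= !oppr_gt0 oppr_eq0.
case: (ltgtP a 0) => //= a0; case: (ltgtP b 0) => //= b0.
by rewrite a0 b0 in xN.
Qed.

Definition small (d : R) x := `|x.1| < d /\ `|x.2| < d.

Lemma smallN d x y : small d (x - y) -> small d (y - x).
Proof. by rewrite /small /= (distrC x.1) (distrC x.2). Qed.

(** As [ahead] changes, the first coordinate of [x] is less than [d] in absolute value; so the
    second one is at least [d] and keeps its sign up to [y]. *)
Lemma above_near d x y : ~ small d x -> small d (x - y) -> ahead x != ahead y ->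
  above x = above y /\ (above (- x) = ~~ above x).
Proof.
case: x y => [a b] [a' b']; rewrite /small /ahead /above /= oppr_gt0 => nx [h1 h2] nxy.
have /ltr_normlP [A1 A2] := h1; have /ltr_normlP [B1 B2] := h2.
have sa : `|a| < d.
  apply/ltr_normlP; move: nxy.
  by case: (ltgtP a 0) => a0; case: (ltgtP a' 0) => a'0 //=; split; lra.
have hb : d <= `|b| by rewrite leNgt; apply/negP => ?; apply: nx.
have [b0|b0] := lerP 0 b; first by rewrite ger0_norm // in hb; split; lra.
by rewrite ltr0_norm // in hb; split; lra.
Qed.

(** When [-x], [-y] cross the upper half axis, [x], [y] cross the lower one; upper and lower
    crossings together are a change of [ahead]. *)
Lemma crossingN d x y : x <> 0 -> y <> 0 -> ~ small d x -> small d (x - y) ->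
  crossing (- x) (- y) = crossing x y (+) (ahead x (+) ahead y).
Proof.
move=> x0 y0 nx xy; rewrite /crossing !aheadN //.
have [-> |/eqP nxy] := pselect (ahead x = ahead y); first by rewrite !addbb !andbF.
have [_ ->] := above_near nx xy nxy.
by case: (ahead x) (ahead y) nxy (above x) => [] [] // _ [].
Qed.

(** The loop [x y w z] is too small to wind around 0. All that is used of this is [H]: between close
    points, [ahead] and [above] do not both change. *)
Lemma crossing_cell d x y z w : ~ small d x -> ~ small d y -> ~ small d z ->
  small d (x - y) -> small d (x - z) -> small d (x - w) ->
  small d (y - w) -> small d (z - w) ->
  crossing x y (+) crossing z w = crossing x z (+) crossing y w.
Proof.
move=> nx ny nz xy xz xw yw zw; rewrite /crossing.
have H a b : ~ small d a -> small d (a - b) ->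
    (ahead a == ahead b) || (above a == above b).
  move=> na ab; case: eqP => //= /eqP nab.
  by case: (above_near na ab nab) => ->.
move: (H _ _ nx xy) (H _ _ nx xz) (H _ _ nx xw) (H _ _ ny yw) (H _ _ nz zw).
case: (ahead x) (ahead y) (ahead z) (ahead w) (above x) (above y) (above z)
  (above w) => [] [] [] [] [] [] [] [] //=.
Qed.

(** A discrete Stokes formula: when [crossing_cell] is summed over all cells, the inner edges of the
    grid cancel modulo 2. *)
Lemma crossing_grid d (M : nat) (f : nat -> nat -> plane R) :
  (forall i j, (i <= M)%N -> (j <= M)%N -> ~ small d (f i j)) ->
  (forall i j i' j', (i <= i' <= i.+1)%N -> (j <= j' <= j.+1)%N ->
     (i' <= M)%N -> (j' <= M)%N -> small d (f i j - f i' j')) ->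
  (\big[addb/false]_(i < M) crossing (f i 0%N) (f i.+1 0%N)) (+)
  (\big[addb/false]_(i < M) crossing (f i M) (f i.+1 M)) =
  (\big[addb/false]_(j < M) crossing (f 0%N j) (f 0%N j.+1)) (+)
  (\big[addb/false]_(j < M) crossing (f M j) (f M j.+1)).
Proof.
move=> nf df.
pose h j := \big[addb/false]_(i < M) crossing (f i j) (f i.+1 j).
have hS j : (j < M)%N ->
    h j (+) h j.+1 = crossing (f 0%N j) (f 0%N j.+1) (+) crossing (f M j) (f M j.+1).
  move=> jM; rewrite /h.
  suff H m : (m <= M)%N ->
    \big[addb/false]_(i < m) crossing (f i j) (f i.+1 j) (+)
    \big[addb/false]_(i < m) crossing (f i j.+1) (f i.+1 j.+1) =
    crossing (f 0%N j) (f 0%N j.+1) (+) crossing (f m j) (f m j.+1) by exact: H.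
  elim: m => [_|m IH mM]; first by rewrite !big_ord0 !addbb.
  have {}IH := IH (ltnW mM).
  rewrite !big_ord_recr /= addbACA IH -addbA; congr (_ (+) _).
  have C : crossing (f m j) (f m.+1 j) (+) crossing (f m j.+1) (f m.+1 j.+1)
         = crossing (f m j) (f m j.+1) (+) crossing (f m.+1 j) (f m.+1 j.+1).
    by apply: (@crossing_cell d); [apply: nf|apply: nf|apply: nf|apply: df|apply: df
      |apply: df|apply: df|apply: df]; rewrite ?leqnn ?leqnSn ?(ltnW mM) ?(ltnW jM).
  by rewrite C addbA addbb addFb.
suff H m : (m <= M)%N -> h 0%N (+) h m =
    \big[addb/false]_(j < m) crossing (f 0%N j) (f 0%N j.+1) (+)
    \big[addb/false]_(j < m) crossing (f M j) (f M j.+1) by exact: H.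
elim: m => [_|m IH mM]; first by rewrite !big_ord0 !addbb.
rewrite !big_ord_recr /= addbACA -IH ?(ltnW mM) // -hS //.
by rewrite -addbA [h m (+) _]addbA addbb addFb.
Qed.
End Parity.

(** * Compactness estimates for arcs *)

Section Arcs.
Variable R : realType.
Implicit Types (g : R -> plane R).

Lemma small_ball (d : R) (x y : plane R) : small d (x - y) = ball x d y.
Proof. by rewrite propeqE; split. Qed.

Lemma arc_compact g : {within `[0, 1], continuous g} -> compact (g @` `[0, 1]).
Proof. by move=> cg; apply: continuous_compact => //; exact: segment_compact. Qed.

Lemma arcs_apart g1 g2 :
  {within `[0, 1], continuous g1} -> {within `[0, 1], continuous g2} ->
  (forall s t, 0 <= s <= 1 -> 0 <= t <= 1 -> g1 s <> g2 t) ->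
  exists2 d : R, 0 < d & forall s t, 0 <= s <= 1 -> 0 <= t <= 1 ->
    ~ small d (g1 s - g2 t).
Proof.
move=> c1 c2 dis.
have /compact_near_coveringP K1 := arc_compact c1.
have cl2 : closed (g2 @` `[0, 1]).
  by apply: compact_closed; [exact: norm_hausdorff|exact: arc_compact].
have := K1 R (0 : R)^'+ (fun d x => forall y, (g2 @` `[0, 1]) y -> ~ ball x d y) _.
case.
  move=> _ [s s01 <-].
  have : nbhs (g1 s) (~` (g2 @` `[0, 1])).
    apply: open_nbhs_nbhs; split; first exact: closed_openC.
    by move: s01; rewrite /= in_itv => s01 [t]; rewrite /= in_itv => t01 /esym; apply: dis.
  move=> /nbhs_ballP [r /= r0 rB].
  exists (ball (g1 s) (r / 2), [set d | d < r / 2]); last first.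
    move=> [x d] /= [xs dr] y By xy; apply: (rB y) => //.
    rewrite [r]splitr; apply: ball_triangle xs _.
    by apply: le_ball xy; exact: ltW.
  split; first by apply: nbhsx_ballx; rewrite divr_gt0.
  by apply: nbhs_right_lt; rewrite divr_gt0.
move=> e /= e0 H; exists (e / 2); first by rewrite divr_gt0.
move=> s t s01 t01; rewrite small_ball; apply: (H (e / 2)) => /=.
- rewrite /ball /= sub0r normrN gtr0_norm ?divr_gt0 //.
  by rewrite ltr_pdivrMr // ltr_pMr // ltr1n.
- by rewrite divr_gt0.
- by exists s; rewrite //= in_itv.
- by exists t; rewrite //= in_itv.
Qed.

Lemma arc_unif g : {within `[0, 1], continuous g} ->
  forall e : R, 0 < e -> exists2 d : R, 0 < d & forall s t,
    0 <= s <= 1 -> 0 <= t <= 1 -> `|s - t| < d -> small e (g s - g t).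
Proof.
move=> /subspace_continuousP cg e e0.
have /compact_near_coveringP K := @segment_compact R 0 1.
have := K R (0 : R)^'+ (fun d s => forall t, 0 <= t <= 1 -> 0 <= s <= 1 ->
  `|s - t| < d -> small e (g s - g t)) _.
case.
  move=> s s01.
  have /cg /(_ _) := s01.
  move=> /(_ (ball (g s) (e / 2))) [].
    by apply: nbhsx_ballx; rewrite divr_gt0.
  move=> r /= r0 rB.
  exists (ball s (r / 2), [set d | d < r / 2]); last first.
    move=> [x d] /= [xs dr] y y01 x01 xy; rewrite small_ball [e]splitr.
    apply: (@ball_triangle _ _ (g s)); first apply: ball_sym; apply: rB; rewrite //= ?in_itv //=.
      by apply: le_ball xs; rewrite ler_pdivrMr // ler_pMr // ler1n.
    rewrite [r]splitr /ball /= -[s - y](subrKA x).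
    apply: le_lt_trans (ler_normD _ _) _; apply: ltrD => //.
    exact: lt_trans xy dr.
  split; first by apply: nbhsx_ballx; rewrite divr_gt0.
  by apply: nbhs_right_lt; rewrite divr_gt0.
move=> d /= d0 H; exists (d / 2); first by rewrite divr_gt0.
move=> s t s01 t01 st; apply: (H (d / 2)) => //=.
  rewrite /ball /= sub0r normrN gtr0_norm ?divr_gt0 //.
  by rewrite ltr_pdivrMr // ltr_pMr // ltr1n.
by rewrite divr_gt0.
Qed.
End Arcs.

(** * The parity obstruction for five points *)

Section Kuratowski.
Variable R : realType.
Implicit Types (g : R -> plane R).

(** The mod 2 intersection number of the sampled arc with the vertical ray going up from [v]; it is
    meaningful once the samples are dense compared with the distance from [v] to the arc. *)
Definition sample_crossing (M : nat) g (v : plane R) : bool :=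
  \big[addb/false]_(k < M) crossing (g (k%:R / M%:R) - v) (g (k.+1%:R / M%:R) - v).

Lemma telescope_addb (f : nat -> bool) (M : nat) :
  \big[addb/false]_(k < M) (f k (+) f k.+1) = f 0%N (+) f M.
Proof.
elim: M => [|M IH]; first by rewrite big_ord0 addbb.
by rewrite big_ord_recr /= IH -addbA [f M (+) _]addbA addbb.
Qed.

(** [crossing_grid] is applied to [g2 (j / M) - g1 (i / M)]. On the two sides where the argument of
    [g2] is fixed this is the negative of [g1 - v], and turning it around by [crossingN] produces
    the [ahead] terms. *)
Lemma square_parity g1 g2 :
  {within `[0, 1], continuous g1} -> {within `[0, 1], continuous g2} ->
  (forall s t, 0 <= s <= 1 -> 0 <= t <= 1 -> g1 s <> g2 t) ->
  exists M0 : nat, forall M : nat, (M0 < M)%N ->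
  sample_crossing M g1 (g2 0) (+) sample_crossing M g1 (g2 1) (+)
  (sample_crossing M g2 (g1 0) (+) sample_crossing M g2 (g1 1)) (+)
  (ahead (g1 0 - g2 0) (+) ahead (g1 1 - g2 0) (+)
   (ahead (g1 0 - g2 1) (+) ahead (g1 1 - g2 1))) = false.
Proof.
move=> c1 c2 dis.
have [d d0 dP] := arcs_apart c1 c2 dis.
have d20 : 0 < d / 2 by rewrite divr_gt0.
have [e1 e10 u1] := arc_unif c1 d20.
have [e2 e20 u2] := arc_unif c2 d20.
have e0 : 0 < Num.min e1 e2 by rewrite lt_min e10.
exists (Num.bound (Num.min e1 e2)^-1) => M MM.
have M0 : (0 : R) < M%:R by rewrite ltr0n; apply: leq_ltn_trans MM.
have Me : M%:R^-1 < Num.min e1 e2.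
  rewrite invf_plt ?posrE //.
  by apply: lt_trans (archi_boundP _) _; rewrite ?ltr_nat ?invr_ge0 ?ltW.
have t01 (k : nat) : (k <= M)%N -> 0 <= (k%:R / M%:R : R) <= 1.
  by move=> kM; rewrite divr_ge0 //= ler_pdivrMr // mul1r ler_nat.
have mesh (k l : nat) : (k <= l <= k.+1)%N ->
    `|k%:R / M%:R - l%:R / M%:R : R| < Num.min e1 e2.
  move=> /andP [kl lk]; apply: le_lt_trans Me.
  rewrite -mulrBl normrM [ `|_^-1| ]gtr0_norm ?invr_gt0 //.
  rewrite -[leRHS]mul1r ler_pM2r ?invr_gt0 // distrC -natrB //.
  by rewrite normr_nat -[1]/(1%:R) ler_nat; lia.
pose f i j := g2 (j%:R / M%:R) - g1 (i%:R / M%:R).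
have nf i j : (i <= M)%N -> (j <= M)%N -> ~ small d (f i j).
  by move=> iM jM /smallN; apply: dP; apply: t01.
have sf i j i' j' : (i <= M)%N -> (j <= M)%N -> (i' <= M)%N -> (j' <= M)%N ->
    `|i%:R / M%:R - i'%:R / M%:R : R| < Num.min e1 e2 ->
    `|j%:R / M%:R - j'%:R / M%:R : R| < Num.min e1 e2 -> small d (f i j - f i' j').
  move=> iM jM i'M j'M; rewrite !lt_min => /andP [H1 _] /andP [_ H2].
  have /= [] := u1 _ _ (t01 _ i'M) (t01 _ iM); first by rewrite distrC.
  have /= [] := u2 _ _ (t01 _ jM) (t01 _ j'M) H2.
  rewrite /small /f /=; do 4!move=> /ltr_normlP [? ?].
  by split; apply/ltr_normlP; split; lra.
have := @crossing_grid R d M f nf _.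
have -> : \big[addb/false]_(j < M) crossing (f 0%N j) (f 0%N j.+1) =
    sample_crossing M g2 (g1 0).
  by apply: eq_bigr => j _; rewrite /f mul0r.
have -> : \big[addb/false]_(j < M) crossing (f M j) (f M j.+1) =
    sample_crossing M g2 (g1 1).
  by apply: eq_bigr => j _; rewrite /f divff // gt_eqF.
have flip j : (j <= M)%N -> \big[addb/false]_(i < M) crossing (f i j) (f i.+1 j) =
    sample_crossing M g1 (g2 (j%:R / M%:R)) (+)
    (ahead (g1 0 - g2 (j%:R / M%:R)) (+) ahead (g1 1 - g2 (j%:R / M%:R))).
  move=> jM; pose a i := ahead (g1 (i%:R / M%:R) - g2 (j%:R / M%:R)).
  have -> : ahead (g1 0 - g2 (j%:R / M%:R)) (+) ahead (g1 1 - g2 (j%:R / M%:R)) =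
      a 0%N (+) a M by rewrite /a mul0r divff // gt_eqF.
  rewrite -telescope_addb -big_split /=; apply: eq_bigr => i _.
  have iM := ltn_ord i.
  have ns k : (k <= M)%N -> ~ small d (g1 (k%:R / M%:R) - g2 (j%:R / M%:R)).
    by move=> kM /smallN; exact: nf.
  have n0 k : (k <= M)%N -> g1 (k%:R / M%:R) - g2 (j%:R / M%:R) <> 0.
    by move=> kM E; apply: (ns k kM); rewrite E /small /= normr0.
  rewrite /f -[X in crossing X _]opprB -[X in crossing _ X]opprB.
  rewrite (@crossingN _ d) //; [exact: n0 (ltnW iM)|exact: n0|exact: ns (ltnW iM)|].
  rewrite opprB addrC -[X in _ + X]opprB; apply: (sf i.+1 j i j) => //.
  - exact: ltnW.
  - by rewrite distrC; apply: mesh; rewrite leqnn leqnSn.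
  - by apply: mesh; rewrite leqnn leqnSn.
rewrite (flip 0%N) // (flip M) // mul0r divff ?gt_eqF // => E; rewrite addbACA in E.
rewrite addbAC E ?addbb // => i j i' j' /andP[ii i'i] /andP[jj j'j] i'M j'M.
by apply: sf; rewrite ?(leq_trans ii) ?(leq_trans jj) //; apply: mesh; apply/andP.
Qed.

Definition parity_of (b : bool) : int := if b then 1 else 0.

Lemma addb8_even (a b c d e f g h : bool) (z := parity_of) :
  a (+) b (+) (c (+) d) (+) (e (+) f (+) (g (+) h)) = false ->
  exists k : int, z a + z b + z c + z d + z e + z f + z g + z h = k + k.
Proof.
by case: a b c d e f g h => [] [] [] [] [] [] [] [] //= _;
  do ?[by exists 0 | by exists 1 | by exists 2 | by exists 3 | by exists 4].
Qed.

Lemma independent_pairs_odd (S : nat -> nat -> nat -> int) (T : nat -> nat -> int) :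
  (forall i j, (i < j < 5)%N -> T j i = 1 - T i j) ->
  (forall i j k l, all (fun x => x < 5)%N [:: i; j; k; l] -> uniq [:: i; j; k; l] ->
     exists m, S i j k + S i j l + S k l i + S k l j + T i k + T j k + T i l + T j l
               = m + m) ->
  False.
Proof.
move=> anti even.
move: (anti 1 2)%N (anti 1 3)%N (anti 2 3)%N (anti 1 4)%N (anti 2 4)%N (anti 3 4)%N.
do 6!(move=> /(_ isT) ?).
have [k0123 F0123] := even 0%N 1%N 2%N 3%N isT isT.
have [k0124 F0124] := even 0%N 1%N 2%N 4%N isT isT.
have [k0134 F0134] := even 0%N 1%N 3%N 4%N isT isT.
have [k0213 F0213] := even 0%N 2%N 1%N 3%N isT isT.
have [k0214 F0214] := even 0%N 2%N 1%N 4%N isT isT.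
have [k0234 F0234] := even 0%N 2%N 3%N 4%N isT isT.
have [k0312 F0312] := even 0%N 3%N 1%N 2%N isT isT.
have [k0314 F0314] := even 0%N 3%N 1%N 4%N isT isT.
have [k0324 F0324] := even 0%N 3%N 2%N 4%N isT isT.
have [k0412 F0412] := even 0%N 4%N 1%N 2%N isT isT.
have [k0413 F0413] := even 0%N 4%N 1%N 3%N isT isT.
have [k0423 F0423] := even 0%N 4%N 2%N 3%N isT isT.
have [k1234 F1234] := even 1%N 2%N 3%N 4%N isT isT.
have [k1324 F1324] := even 1%N 3%N 2%N 4%N isT isT.
have [k1423 F1423] := even 1%N 4%N 2%N 3%N isT isT.
(* Each [S i j k] occurs in two of the fifteen equations, and each unordered pair of indices in six
   [T] terms. Every four-element subset contributes three [T] terms with decreasing indices, fifteen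
   in all, and replacing [T j i] by [1 - T i j] in them makes the total odd. *)
lia.
Qed.

(* Van Kampen's argument: summed over the fifteen pairs of independent edges,
   every term of [square_parity] that depends on the arcs occurs twice, while
   the terms that only depend on the vertices add up to 1. *)
Lemma complete5_not_planar (p : 'I_5 -> plane R) (g : 'I_5 -> 'I_5 -> R -> plane R) :
  injective p ->
  (forall i j, i != j ->
     [/\ {within `[0, 1], continuous g i j}, g i j 0 = p i & g i j 1 = p j]) ->
  (forall i j k l s t, uniq [:: i; j; k; l] -> 0 <= s <= 1 -> 0 <= t <= 1 ->
     g i j s <> g k l t) -> False.
Proof.
move=> pinj ends dis.
pose sq (M : nat) (q : 'I_5 * 'I_5 * ('I_5 * 'I_5)) := let: ((i, j), (k, l)) := q in
  sample_crossing M (g i j) (p k) (+) sample_crossing M (g i j) (p l) (+)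
  (sample_crossing M (g k l) (p i) (+) sample_crossing M (g k l) (p j)) (+)
  (ahead (p i - p k) (+) ahead (p j - p k) (+) (ahead (p i - p l) (+) ahead (p j - p l))).
(* A single [M] serves all pairs of edges, so that the terms shared by two equations are literally
   equal. *)
have [M sqM] : exists M, forall q, uniq [:: q.1.1; q.1.2; q.2.1; q.2.2] -> sq M q = false.
  suff [M HM] : exists M0, forall q, uniq [:: q.1.1; q.1.2; q.2.1; q.2.2] ->
      forall M, (M0 < M)%N -> sq M q = false by exists M.+1 => q uq; exact: HM.
  have H q : exists M0, uniq [:: q.1.1; q.1.2; q.2.1; q.2.2] ->
      forall M, (M0 < M)%N -> sq M q = false.
    case: q => [[i j] [k l]] /=.
    have [uq|] := boolP (uniq [:: i; j; k; l]); last first.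
      by move=> /negPf nuq; exists 0%N => uq; move: nuq; rewrite /= uq.
    have ij : i != j by move: uq; rewrite /= !inE; case: eqP.
    have kl : k != l by move: uq; rewrite /= !inE => /and4P [_ _ ? _].
    have [c1 e10 e11] := ends _ _ ij; have [c2 e20 e21] := ends _ _ kl.
    have [M0 HM0] := square_parity c1 c2 (fun s t => dis i j k l s t uq).
    by exists M0 => _ M /HM0; rewrite e10 e11 e20 e21.
  have [F HF] := choice H.
  exists (\max_q F q)%N => q uq M FM; apply: HF => //.
  by apply: leq_ltn_trans FM; apply: leq_bigmax.
have anti i j : i != j -> ahead (p i - p j) (+) ahead (p j - p i) = true.
  move=> ij; rewrite -opprB aheadN ?addNb ?addbb //.
  by move/eqP; rewrite subr_eq0 => /eqP /pinj ji; rewrite ji eqxx in ij.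
pose o i := @inord 4 i.
have oo i j : (i < 5)%N -> (j < 5)%N -> (o i == o j) = (i == j).
  by move=> i5 j5; rewrite -val_eqE /= !inordK.
have E i j k l : (i < 5)%N -> (j < 5)%N -> (k < 5)%N -> (l < 5)%N ->
    uniq [:: i; j; k; l] -> sq M ((o i, o j), (o k, o l)) = false.
  by move=> i5 j5 k5 l5 uq; apply: sqM; move: uq; rewrite /= !inE !oo.
apply: (@independent_pairs_odd
  (fun i j k => parity_of (sample_crossing M (g (o i) (o j)) (p (o k))))
  (fun i j => parity_of (ahead (p (o i) - p (o j))))) => [i j /andP [ij j5]|i j k l].
  have /anti : o i != o j by rewrite oo ?(ltn_trans ij) // ltn_eqF.
  by do 2!case: ahead.
by move=> /and5P [i5 j5 k5 l5 _] uq; apply/addb8_even/E.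
Qed.
End Kuratowski.

(** * Homeomorphisms of the plane *)

Section Homeo.
Variable R : realType.

Record homeo := Homeo {
  hfun :> plane R -> plane R;
  hinv : plane R -> plane R;
  hfun_cts : continuous hfun;
  hinv_cts : continuous hinv;
  hfunK : cancel hfun hinv;
  hinvK : cancel hinv hfun }.

Definition homeo_id : homeo.
Proof. by exists id id => // x; exact: cvg_id. Defined.

Definition homeo_comp (g h : homeo) : homeo.
Proof.
exists (g \o h) (hinv h \o hinv g).
- by move=> x; apply: continuous_comp; exact: hfun_cts.
- by move=> x; apply: continuous_comp; exact: hinv_cts.
- exact: can_comp (hfunK g) (hfunK h).
- exact: can_comp (hinvK h) (hinvK g).
Defined.

Definition homeo_inv (h : homeo) : homeo :=
  Homeo (@hinv_cts h) (@hfun_cts h) (@hinvK h) (@hfunK h).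

Lemma plane_continuous (T : topologicalType) (f g : T -> R) :
  continuous f -> continuous g -> continuous (fun p => (f p, g p) : plane R).
Proof. by move=> cf cg x; apply: (cvg_pair (cf x) (cg x)). Qed.

Definition aff (a b c : R) (p : plane R) : R := a * p.1 + b * p.2 + c.

Lemma aff_continuous a b c : continuous (aff a b c).
Proof.
move=> x; apply: cvgD; last exact: cvg_cst.
by apply: cvgD; apply: cvgM; try exact: cvg_cst; [exact: cvg_fst|exact: cvg_snd].
Qed.

(* A pyramid over the polygon where all four functions are nonnegative; a triangle
   is obtained by repeating one of them. *)
Definition tent (l1 l2 l3 l4 : plane R -> R) (p : plane R) : R :=
  Num.max 0 (Num.min (Num.min (l1 p) (l2 p)) (Num.min (l3 p) (l4 p))).

Lemma tent_continuous l1 l2 l3 l4 : continuous l1 -> continuous l2 ->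
  continuous l3 -> continuous l4 -> continuous (tent l1 l2 l3 l4).
Proof.
move=> c1 c2 c3 c4 x.
have cm (f g : plane R -> R) : continuous f -> continuous g ->
    continuous (fun p => Num.min (f p) (g p)).
  by move=> cf cg y; apply: (@continuous_min R _ f g y (cf y) (cg y)).
apply: (@continuous_max R _ (fun=> 0) _ x (@cvg_cst _ _ _ _ _)).
by apply/cm; apply/cm.
Qed.

Definition push (v : plane R) (t : R) (p : plane R) : plane R :=
  (p.1 + t * v.1, p.2 + t * v.2).

Lemma pushK v t : cancel (push v t) (push (- v) t).
Proof. by case=> a b; rewrite /push /=; congr pair; ring. Qed.

Lemma pushNK v t : cancel (push (- v) t) (push v t).
Proof. by rewrite -{2}[v]opprK; exact: pushK. Qed.

(* l' is the affine function that vanishes where l does and takes the same value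
   at [push v 1 c] as l at the centre [c] (where both are 1). *)
Definition pushed (v : plane R) (l l' : plane R -> R) :=
  exists2 r : R, 0 < r & forall p t, l' (push v t p) - t = r * (l p - t).

Lemma pushedN v l l' : pushed v l l' -> pushed (- v) l' l.
Proof.
case=> r r0 H; exists r^-1; first by rewrite invr_gt0.
move=> p t; have := H (push (- v) t p) t.
rewrite pushNK => ->; rewrite mulKf // gt_eqF //.
Qed.

(** That a tent has value [t] at a point depends only on the signs of its four functions minus [t]
    there, and [pushed] says that these signs survive the push by [t]. *)
Lemma tent_push v l1 l2 l3 l4 m1 m2 m3 m4 p :
  pushed v l1 m1 -> pushed v l2 m2 -> pushed v l3 m3 -> pushed v l4 m4 ->
  tent m1 m2 m3 m4 (push v (tent l1 l2 l3 l4 p) p) = tent l1 l2 l3 l4 p.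
Proof.
move=> H1 H2 H3 H4; move tE: (tent l1 l2 l3 l4 p) => t.
have le l m : pushed v l m ->
    ((m (push v t p) <= t) = (l p <= t)) * ((t <= m (push v t p)) = (t <= l p)).
  case=> r r0 H; split.
    by rewrite -subr_le0 H pmulr_rle0 // subr_le0.
  by rewrite -subr_ge0 H pmulr_rge0 // subr_ge0.
apply/eqP; rewrite eq_le /tent ge_max !ge_min !(le _ _ H1) !(le _ _ H2) !(le _ _ H3) !(le _ _ H4).
rewrite le_max !le_min !(le _ _ H1) !(le _ _ H2) !(le _ _ H3) !(le _ _ H4).
by rewrite -!le_min -!ge_min -ge_max -le_max -eq_le -/(tent _ _ _ _ _) tE.
Qed.

Lemma tent_eq0 l1 l2 l3 l4 p :
  [|| l1 p <= 0, l2 p <= 0, l3 p <= 0 | l4 p <= 0] -> tent l1 l2 l3 l4 p = 0.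
Proof. by move=> H; apply/max_idPl; rewrite !ge_min -orbA. Qed.

Lemma tent_eq c l1 l2 l3 l4 p : 0 <= c -> [&& c <= l1 p, c <= l2 p, c <= l3 p & c <= l4 p] ->
  [|| l1 p <= c, l2 p <= c, l3 p <= c | l4 p <= c] -> tent l1 l2 l3 l4 p = c.
Proof.
move=> c0 H H'; apply/eqP; rewrite eq_le /tent ge_max c0 !ge_min -orbA H' /=.
by rewrite le_max !le_min -andbA H orbT.
Qed.

Lemma push_continuous v (f : plane R -> R) : continuous f ->
  continuous (fun p => push v (f p) p).
Proof.
move=> cf; apply: plane_continuous => x; apply: cvgD.
- exact: cvg_fst.
- by apply: cvgM; [exact: cf|exact: cvg_cst].
- exact: cvg_snd.
- by apply: cvgM; [exact: cf|exact: cvg_cst].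
Qed.

(** The map moves the apex by [v] and fixes every point where one of the [l] is nonpositive. The [m]
    describe the tent with the same base and the moved apex; the height of a point is preserved, so
    pushing back by that height is the inverse. *)
Lemma tent_homeo v l1 l2 l3 l4 m1 m2 m3 m4 :
  continuous l1 -> continuous l2 -> continuous l3 -> continuous l4 ->
  continuous m1 -> continuous m2 -> continuous m3 -> continuous m4 ->
  pushed v l1 m1 -> pushed v l2 m2 -> pushed v l3 m3 -> pushed v l4 m4 ->
  exists h : homeo, forall p, h p = push v (tent l1 l2 l3 l4 p) p.
Proof.
move=> cl1 cl2 cl3 cl4 cm1 cm2 cm3 cm4 H1 H2 H3 H4.
unshelve eexists (@Homeo (fun p => push v (tent l1 l2 l3 l4 p) p)
  (fun p => push (- v) (tent m1 m2 m3 m4 p) p) _ _ _ _) => //.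
- by apply/push_continuous/tent_continuous.
- by apply/push_continuous/tent_continuous.
- by move=> p; rewrite tent_push // pushK.
- move=> p; rewrite (@tent_push (- v)); try exact: pushedN.
  by rewrite pushNK.
Qed.

Lemma aff_homeo a b c d e f a' b' c' d' e' f' :
  (forall p, aff a' b' c' (aff a b c p, aff d e f p) = p.1 /\
             aff d' e' f' (aff a b c p, aff d e f p) = p.2) ->
  (forall p, aff a b c (aff a' b' c' p, aff d' e' f' p) = p.1 /\
             aff d e f (aff a' b' c' p, aff d' e' f' p) = p.2) ->
  exists h : homeo, forall p, h p = (aff a b c p, aff d e f p).
Proof.
move=> H1 H2.
unshelve eexists (@Homeo (fun p => (aff a b c p, aff d e f p))
  (fun p => (aff a' b' c' p, aff d' e' f' p)) _ _ _ _) => //.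
- by apply: plane_continuous; exact: aff_continuous.
- by apply: plane_continuous; exact: aff_continuous.
- by move=> p; have [-> ->] := H1 p; case: p.
- by move=> p; have [-> ->] := H2 p; case: p.
Qed.

End Homeo.

(** * Flips of the canonical straight drawing *)

Section Canonical.
Variable R : realType.
Local Notation homeo := (homeo R).
Local Notation aff := (@aff R).

Definition seg (p q : plane R) (t : R) : plane R :=
  ((1 - t) * p.1 + t * q.1, (1 - t) * p.2 + t * q.2).

Lemma segC p q t : seg p q t = seg q p (1 - t).
Proof. by rewrite /seg; congr pair; ring. Qed.

Lemma seg0 p q : seg p q 0 = p.
Proof. by case: p => a b; rewrite /seg; congr pair; rewrite /=; ring. Qed.

Lemma seg1 p q : seg p q 1 = q.
Proof. by case: q => a b; rewrite /seg; congr pair; rewrite /=; ring. Qed.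

Definition straight (S : seq (plane R)) (i : nat) : plane R := nth (0, 0) S i.

(* The poles are 0 and 4, the equator is 1, 2, 3, the outer face is 0, 1, 2, and
   the edge from 0 to 4 is missing. *)
Definition five : seq (plane R) := [:: (0, 0); (5, 0); (0, 5); (1, 1); (3, 1)].
Definition Q := straight five.

(* [h] maps the straight drawing on [S], relabelled by [pi], to the one on [T],
   except for the edges in [E]. *)
Definition carries (h : homeo) (E : seq (nat * nat)) (S T : seq (plane R))
    (pi : nat -> nat) :=
  forall i j, (i < j < 5)%N -> (i, j) \notin E -> forall t, 0 <= t <= 1 ->
    h (seg (straight S (pi i)) (straight S (pi j)) t) = seg (straight T i) (straight T j) t.

(** The default is the index itself, so a list shorter than five fixes the remaining indices. *)
Definition relabel (l : seq nat) (i : nat) := nth i l i.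

Lemma carriesC h E S T pi i j : carries h E S T pi -> i != j -> (i < 5)%N -> (j < 5)%N ->
  (i, j) \notin E -> (j, i) \notin E -> forall t, 0 <= t <= 1 ->
  h (seg (straight S (pi i)) (straight S (pi j)) t) = seg (straight T i) (straight T j) t.
Proof.
move=> H ij i5 j5 nij nji t t01; have [lij|lji|e] := ltngtP i j; last by rewrite e eqxx in ij.
  by rewrite H ?lij.
by rewrite segC H ?lji // -?segC //; lra.
Qed.

Lemma carries_comp h g E S T U pi rho : carries h E T U id -> carries g E S T pi ->
  rho =1 pi -> carries (homeo_comp h g) E S U rho.
Proof.
move=> H G e i j ij nE t t01; rewrite !e /=.
by rewrite (G i j) // (H i j).
Qed.

Lemma carries_inv h E S T : carries h E S T id -> carries (homeo_inv h) E T S id.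
Proof. by move=> H i j ij nE t t01; rewrite -(H i j) //; exact: hfunK. Qed.

Lemma lt5_ind2 (P : nat -> nat -> Prop) : (P 0 1 -> P 0 2 -> P 0 3 -> P 0 4 ->
  P 1 2 -> P 1 3 -> P 1 4 -> P 2 3 -> P 2 4 -> P 3 4 ->
  forall i j, i < j < 5 -> P i j)%N.
Proof.
move=> ? ? ? ? ? ? ? ? ? ? i j.
by case: i j => [|[|[|[|[|i]]]]] [|[|[|[|[|j]]]]] //; rewrite andbF.
Qed.

Ltac some_lra := first [lra | apply/orP; left; lra | apply/orP; right; some_lra].

Ltac eval_tent :=
  match goal with |- context [tent ?a ?b ?c ?d ?p] =>
    let value e := (have -> : tent a b c d p = e;
      [solve [apply: tent_eq0; rewrite /aff /=; some_lra
             |apply: tent_eq; rewrite /aff /=; [lra|apply/and4P; split; lra|some_lra]]|]) in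
    first [value (0 : R) | value (a p) | value (b p) | value (c p) | value (d p)]
  end.

Ltac segments hE :=
  apply: lt5_ind2 => //= _ t /andP [t0 t1]; rewrite hE /straight /seg /=;
  try eval_tent; rewrite /push /aff /=; congr pair; lra.

Ltac aff_id := by move=> p; rewrite /aff /=; split; ring.

(** The coordinates in [five] make this affine: the involution [(x, y) -> (5 - x - y, y)] exchanges
    0 with 1 and 3 with 4, and fixes 2. *)
Lemma flip13 :
  exists h, carries h [:: (1, 3); (0, 4)]%N five five (relabel [:: 1; 0; 2; 4; 3]%N).
Proof.
have [||h hE] := @aff_homeo R (-1) (-1) 5 0 1 0 (-1) (-1) 5 0 1 0; try aff_id.
by exists h; segments hE.
Qed.

(* The reflection that exchanges 1 and 2 and fixes 0 and 3 moves 4 from (3, 1) to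
   (1, 3); a push inside the triangle 1 2 3 brings it back. *)
Lemma swap12 : exists h, carries h [:: (0, 4)]%N five five (relabel [:: 0; 2; 1]%N).
Proof.
have [||f fE] := @aff_homeo R 0 1 0 1 0 0 0 1 0 1 0 0; try aff_id.
(* The functions vanish on the sides of the triangle 1 2 3, the last side being repeated. They are
   normalised to 1 at (1, 3) in the first row and at (3, 1) in the second; the numbers supplied
   below are the ratios of the two normalisations. *)
have [|||||||||||| g gE] := @tent_homeo R (2, -2)
  (aff 8^-1 (4 / 8) (-5 / 8)) (aff 2 2^-1 (-5 / 2)) (aff (-1) (-1) 5) (aff (-1) (-1) 5)
  (aff 2^-1 2 (-5 / 2)) (aff (4 / 8) 8^-1 (-5 / 8)) (aff (-1) (-1) 5) (aff (-1) (-1) 5).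
all: try exact: aff_continuous.
- by exists 4; [lra|move=> p t; rewrite /push /aff /=; lra].
- by exists 4^-1; [lra|move=> p t; rewrite /push /aff /=; lra].
- by exists 1; [lra|move=> p t; rewrite /push /aff /=; lra].
- by exists 1; [lra|move=> p t; rewrite /push /aff /=; lra].
exists (homeo_comp g f).
apply: (@carries_comp _ _ [:: (0, 4)]%N _ [:: (0, 0); (5, 0); (0, 5); (1, 1); (1, 3)]
  _ (relabel [:: 0; 2; 1]%N)) => //; first by segments gE.
by segments fE.
Qed.

(** The relabelling of [swap12] turns the edge 2 3 into 1 3, so [flip13] followed by [swap12] does
    it. *)
Lemma flip23 :
  exists h, carries h [:: (2, 3); (0, 4)]%N five five (relabel [:: 1; 2; 0; 4; 3]%N).
Proof.
have [h H] := flip13; have [s S] := swap12; exists (homeo_comp s h) => i j ij nE t t01.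
rewrite /= -[RHS](S i j) //; last by move: nE; rewrite !inE => /norP [].
have e k : (k < 5)%N -> relabel [:: 1; 2; 0; 4; 3]%N k =
    relabel [:: 1; 0; 2; 4; 3]%N (relabel [:: 0; 2; 1]%N k) by case: k => [|[|[|[|[|]]]]].
have /andP [lij j5] := ij; rewrite !e ?(ltn_trans lij) //.
congr (s _); apply: (carriesC H) => // {t t01};
  by move: i j ij nE {lij j5}; apply: lt5_ind2.
Qed.

(* Pushing 4 to (5, 5) makes 0, 1, 4, 2 the corners of a square; its reflection
   moves 3 from (1, 1) to (4, 1), and a push inside the square brings it back. *)
Lemma flip12 :
  exists h, carries h [:: (1, 2); (0, 4)]%N five five (relabel [:: 1; 0; 4; 3; 2]%N).
Proof.
(* The base is the wedge at 3 through 1 and 2, cut off by the line [x + y = 14], which lies beyond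
   (5, 5). The push bends the edge 1 2, which [E] excludes. *)
have [|||||||||||| f fE] := @tent_homeo R (2, 4)
  (aff (4 / 8) 8^-1 (-5 / 8)) (aff 2^-1 2 (-5 / 2)) (aff (-1 / 10) (-1 / 10) (14 / 10))
    (aff (-1 / 10) (-1 / 10) (14 / 10))
  (aff (4 / 20) 20^-1 (-5 / 20)) (aff 20^-1 (4 / 20) (-5 / 20)) (aff (-1 / 4) (-1 / 4) (14 / 4))
    (aff (-1 / 4) (-1 / 4) (14 / 4)).
all: try exact: aff_continuous.
- by exists (8 / 20); [lra|move=> p t; rewrite /push /aff /=; lra].
- by exists (2 / 20); [lra|move=> p t; rewrite /push /aff /=; lra].
- by exists (10 / 4); [lra|move=> p t; rewrite /push /aff /=; lra].
- by exists (10 / 4); [lra|move=> p t; rewrite /push /aff /=; lra].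
have [||g gE] := @aff_homeo R (-1) 0 5 0 1 0 (-1) 0 5 0 1 0; try aff_id.
have [|||||||||||| k kE] := @tent_homeo R (-3, 0)
  (aff 4^-1 0 0) (aff (-1) 0 5) (aff 0 1 0) (aff 0 (-1 / 4) (5 / 4))
  (aff 1 0 0) (aff (-1 / 4) 0 (5 / 4)) (aff 0 1 0) (aff 0 (-1 / 4) (5 / 4)).
all: try exact: aff_continuous.
- by exists 4; [lra|move=> p t; rewrite /push /aff /=; lra].
- by exists (4^-1); [lra|move=> p t; rewrite /push /aff /=; lra].
- by exists 1; [lra|move=> p t; rewrite /push /aff /=; lra].
- by exists 1; [lra|move=> p t; rewrite /push /aff /=; lra].
pose E := [:: (1, 2); (0, 4)]%N.
pose square : seq (plane R) := [:: (0, 0); (5, 0); (0, 5); (1, 1); (5, 5)].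
pose square' : seq (plane R) := [:: (0, 0); (5, 0); (0, 5); (4, 1); (5, 5)].
have F : carries f E five square id by segments fE.
have G : carries g E square square' (relabel [:: 1; 0; 4; 3; 2]%N) by segments gE.
have K : carries k E square' square id by segments kE.
exists (homeo_comp (homeo_inv f) (homeo_comp k (homeo_comp g f))).
apply: carries_comp (carries_inv F) _ (fun i => erefl _).
apply: carries_comp K _ (fun i => erefl _).
move=> i j ij nE t t01; rewrite -(G i j) //=; congr (g _).
apply: (carriesC F) => // {t t01}; by move: i j ij nE; apply: lt5_ind2.
Qed.

Lemma canonical_flip l m : (0 < l < m)%N -> (m < 4)%N ->
  exists h pi, [/\ carries h [:: (l, m); (0, 4)]%N five five pi,
    {in gtn 5 &, injective pi}, (forall i, (i < 5)%N -> (pi i < 5)%N)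
    & (pi l, pi m) = (0, 4)%N \/ (pi l, pi m) = (4, 0)%N].
Proof.
case: l m => [|[|[|l]]] [|[|[|[|m]]]] // _ _.
- have [h H] := flip12; exists h, (relabel [:: 1; 0; 4; 3; 2]%N).
  split=> //; [|by case=> [|[|[|[|[|]]]]]|by left].
  by move=> [|[|[|[|[|i]]]]] [|[|[|[|[|j]]]]].
- have [h H] := flip13; exists h, (relabel [:: 1; 0; 2; 4; 3]%N).
  split=> //; [|by case=> [|[|[|[|[|]]]]]|by left].
  by move=> [|[|[|[|[|i]]]]] [|[|[|[|[|j]]]]].
- have [h H] := flip23; exists h, (relabel [:: 1; 2; 0; 4; 3]%N).
  split=> //; [|by case=> [|[|[|[|[|]]]]]|by left].
  by move=> [|[|[|[|[|i]]]]] [|[|[|[|[|j]]]]].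
Qed.


End Canonical.

(** * Triangles *)

Section Triangle.
Variable R : realType.
Implicit Types (A B C P X : plane R).
Local Notation plane := (plane R).

Definition segment A B : set plane := [set X | exists2 t, 0 <= t <= 1 & X = seg A B t].

Lemma segmentC A B : segment A B = segment B A.
Proof.
apply/seteqP; split=> X [t t01 ->]; exists (1 - t); first lra.
- exact: segC.
- lra.
- exact: segC.
Qed.

Definition cross A B X : R := (B.1 - A.1) * (X.2 - A.2) - (B.2 - A.2) * (X.1 - A.1).

Lemma crossE A B X :
  cross A B X = aff (- (B.2 - A.2)) (B.1 - A.1) ((B.2 - A.2) * A.1 - (B.1 - A.1) * A.2) X.
Proof. rewrite /cross /aff; ring. Qed.

Definition half (a b c : R) : set plane := [set X | 0 < aff a b c X].

Lemma aff_seg a b c A B t : aff a b c (seg A B t) = (1 - t) * aff a b c A + t * aff a b c B.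
Proof. rewrite /aff /seg /=; ring. Qed.

Lemma half_open a b c : open (half a b c).
Proof.
have -> : half a b c = aff a b c @^-1` [set r | 0 < r] by [].
apply: open_comp => [x _|]; [exact: aff_continuous|exact: open_gt].
Qed.

Lemma seg_continuous A B : continuous (seg A B).
Proof.
have line (u v : R) : continuous (fun t : R => (1 - t) * u + t * v).
  move=> t; apply: cvgD; apply: cvgM; try exact: cvg_cst; last exact: cvg_id.
  by apply: cvgB; [exact: cvg_cst|exact: cvg_id].
by apply: plane_continuous; exact: line.
Qed.

Lemma plane_segment_connected A B : connected (segment A B).
Proof.
have -> : segment A B = seg A B @` `[0, 1].
  by apply/seteqP; split=> X [t]; rewrite /= ?in_itv => t01; [move=> ->|move=> <-];
     exists t; rewrite //= in_itv.
apply: connected_continuous_connected; first exact: segment_connected.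
exact/continuous_subspaceT/seg_continuous.
Qed.

Definition convex_set (U : set plane) :=
  forall A B t, U A -> U B -> 0 <= t <= 1 -> U (seg A B t).

Lemma half_convex a b c : convex_set (half a b c).
Proof.
move=> A B t; rewrite /half /= aff_seg => hA hB /andP [t0 t1].
have [->|tN] := eqVneq t 0; first by rewrite subr0 mul1r mul0r addr0.
have tp : 0 < t by rewrite lt_def tN.
have := mulr_gt0 tp hB; have : 0 <= (1 - t) * aff a b c A.
  by apply: mulr_ge0; [rewrite subr_ge0|exact: ltW].
lra.
Qed.

Lemma convexI U V : convex_set U -> convex_set V -> convex_set (U `&` V).
Proof. by move=> cU cV A B t [? ?] [? ?] t01; split; [exact: cU|exact: cV]. Qed.

Lemma convex_connected U : convex_set U -> connected U.
Proof.
move=> cU; have [[A UA]|/forallNP U0] := pselect (exists A, U A); last first.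
  by rewrite (_ : U = set0); [exact: connected0|apply/seteqP; split=> // X /U0].
have -> : U = \bigcup_(B in U) segment A B.
  apply/seteqP; split=> [X UX|X [B UB [t t01 ->]]]; last exact: cU.
  by exists X => //; exists 1; rewrite ?seg1 // ler01 lexx.
apply: bigcup_connected => [|B _]; last exact: plane_segment_connected.
by exists A => B _; exists 0; rewrite ?seg0 // ler01 lexx.
Qed.

Definition area A B C : R := cross A B C.

Definition inside A B C : set plane := [set X | [/\ 0 < area A B C * cross B C X,
  0 < area A B C * cross C A X & 0 < area A B C * cross A B X]].
Definition outside A B C : set plane := [set X | [\/ area A B C * cross B C X < 0,
  area A B C * cross C A X < 0 | area A B C * cross A B X < 0]].
Definition triangle A B C : set plane := segment A B `|` segment B C `|` segment C A.

Lemma area_cross A B C X : area A B C = cross B C X + cross C A X + cross A B X.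
Proof. by rewrite /area /cross; ring. Qed.

Lemma cross_half (e : R) A B : exists a b c,
  forall X, e * cross A B X = aff a b c X.
Proof.
exists (e * - (B.2 - A.2)), (e * (B.1 - A.1)),
  (e * ((B.2 - A.2) * A.1 - (B.1 - A.1) * A.2)) => X.
by rewrite crossE /aff; ring.
Qed.

Lemma inside_halves A B C : exists l1 l2 l3 : R * R * R,
  inside A B C = half l1.1.1 l1.1.2 l1.2 `&` half l2.1.1 l2.1.2 l2.2
    `&` half l3.1.1 l3.1.2 l3.2.
Proof.
have [a [b [c H1]]] := cross_half (area A B C) B C.
have [a' [b' [c' H2]]] := cross_half (area A B C) C A.
have [a'' [b'' [c'' H3]]] := cross_half (area A B C) A B.
exists (a, b, c), (a', b', c'), (a'', b'', c'').
apply/seteqP; split=> X; rewrite /inside /half /= H1 H2 H3; first by case.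
by case=> [[]].
Qed.

Lemma outside_halves A B C : exists l1 l2 l3 : R * R * R,
  outside A B C = half l1.1.1 l1.1.2 l1.2 `|` half l2.1.1 l2.1.2 l2.2
    `|` half l3.1.1 l3.1.2 l3.2.
Proof.
have [a [b [c H1]]] := cross_half (- area A B C) B C.
have [a' [b' [c' H2]]] := cross_half (- area A B C) C A.
have [a'' [b'' [c'' H3]]] := cross_half (- area A B C) A B.
exists (a, b, c), (a', b', c'), (a'', b'', c'').
apply/seteqP; split=> X; rewrite /outside /half /= -H1 -H2 -H3 !mulNr !oppr_gt0.
  by case; [left; left|left; right|right].
by case=> [[]|]; [constructor 1|constructor 2|constructor 3].
Qed.

Lemma inside_open A B C : open (inside A B C).
Proof.
by have [? [? [? ->]]] := inside_halves A B C; apply: openI; [apply: openI|]; exact: half_open.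
Qed.

Lemma outside_open A B C : open (outside A B C).
Proof.
by have [? [? [? ->]]] := outside_halves A B C; apply: openU; [apply: openU|]; exact: half_open.
Qed.

Lemma inside_connected A B C : connected (inside A B C).
Proof.
have [? [? [? ->]]] := inside_halves A B C; apply: convex_connected.
by apply: convexI; [apply: convexI|]; exact: half_convex.
Qed.

Lemma outside_connected A B C : area A B C != 0 -> connected (outside A B C).
Proof.
move=> D0; have DD : 0 < area A B C * area A B C by rewrite -expr2 exprn_even_gt0.
pose U1 := [set X | area A B C * cross B C X < 0].
pose U2 := [set X | area A B C * cross C A X < 0].
pose U3 := [set X | area A B C * cross A B X < 0].
have -> : outside A B C = U1 `|` U2 `|` U3.
  apply/seteqP; split=> X; first by case; [left; left|left; right|right].
  by case=> [[]|]; [constructor 1|constructor 2|constructor 3].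
have cU B' C' : connected [set X | area A B C * cross B' C' X < 0].
  apply: convex_connected; have [a [b [c H]]] := cross_half (- area A B C) B' C'.
  rewrite (_ : [set X | _] = half a b c); first exact: half_convex.
  by apply/seteqP; split=> X; rewrite /half /= -H mulNr oppr_gt0.
have neg d : d = - area A B C -> area A B C * d < 0 by move=> ->; rewrite mulrN oppr_lt0.
have hit B' C' X U' : cross B' C' X = - area A B C -> U' X ->
    U' `&` [set X | area A B C * cross B' C' X < 0] !=set0.
  by move=> e U'X; exists X; split=> //; exact: neg.
apply: connectedU; last exact: cU.
  (* Barycentric coordinates (-1, 3, -1): a common point of the first and the third half-plane. The
     point used next, with (-1, -1, 3), links the first two. *)
  apply: (hit _ _ (3 * B.1 - A.1 - C.1, 3 * B.2 - A.2 - C.2)).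
    by rewrite /area /cross /=; ring.
  by left; apply: neg; rewrite /area /cross /=; ring.
apply: connectedU; [|exact: cU..].
apply: (hit _ _ (3 * C.1 - A.1 - B.1, 3 * C.2 - A.2 - B.2)).
  by rewrite /area /cross /=; ring.
by apply: neg; rewrite /area /cross /=; ring.
Qed.

(* [X] has barycentric coordinates [cross B C X], [cross C A X], [cross A B X],
   up to the factor [area A B C]. *)
Lemma cross0_seg A B C X : area A B C != 0 -> cross A B X = 0 ->
  X = seg A B (cross C A X / area A B C).
Proof.
move=> D0 e; have pt (f : plane -> R) :
    area A B C * f X - ((area A B C - cross C A X) * f A + cross C A X * f B) =
      cross A B X * (f C - f A) ->
    f X = (1 - cross C A X / area A B C) * f A + cross C A X / area A B C * f B.
  rewrite e mul0r => /subr0_eq H; apply: (mulfI D0); rewrite {}H.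
  by field.
by case: X e pt => x1 x2 e pt; congr pair; [apply: (pt fst)|apply: (pt snd)];
  rewrite /area /cross /=; ring.
Qed.

Lemma on_segment A B C X : area A B C != 0 -> 0 <= area A B C * cross B C X ->
  0 <= area A B C * cross C A X -> cross A B X = 0 -> segment A B X.
Proof.
move=> D0 h1 h2 h3; exists (cross C A X / area A B C); last exact: cross0_seg.
have DD : 0 < area A B C ^+ 2 by rewrite exprn_even_gt0.
have -> : cross C A X / area A B C = area A B C * cross C A X / area A B C ^+ 2 by field.
rewrite divr_ge0 ?(ltW DD) //= ler_pdivrMr // mul1r -subr_ge0.
suff -> : area A B C ^+ 2 - area A B C * cross C A X = area A B C * cross B C X by [].
by rewrite expr2 -mulrBr {2}(area_cross A B C X) h3; ring.
Qed.

Lemma area_rot A B C : area A B C = area B C A.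
Proof. by rewrite /area /cross; ring. Qed.

Lemma triangle_compl A B C : area A B C != 0 ->
  ~` triangle A B C = inside A B C `|` outside A B C.
Proof.
move=> D0; have D1 : area B C A != 0 by rewrite -area_rot.
have D2 : area C A B != 0 by rewrite -area_rot -area_rot.
apply/seteqP; split=> X.
  move=> nX; have [o|no] := pselect (outside A B C X); [by right|left].
  have nn (d : R) : (d < 0 -> outside A B C X) -> 0 <= d.
    by move=> H; rewrite leNgt; apply/negP => /H.
  have h1 : 0 <= area A B C * cross B C X by apply: nn; constructor 1.
  have h2 : 0 <= area A B C * cross C A X by apply: nn; constructor 2.
  have h3 : 0 <= area A B C * cross A B X by apply: nn; constructor 3.
  split; rewrite lt_def ?h1 ?h2 ?h3 andbT mulf_neq0 //; apply/eqP => e; apply: nX.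
  - by left; right; apply: (@on_segment _ _ A) => //; rewrite -area_rot.
  - by right; apply: (@on_segment _ _ B) => //; rewrite -area_rot -area_rot.
  - by left; left; apply: (@on_segment _ _ C).
have crs P1 P2 A' B' t : cross P1 P2 (seg A' B' t) = (1 - t) * cross P1 P2 A' + t * cross P1 P2 B'.
  by rewrite /cross /seg /=; ring.
have DD : 0 < area A B C * area A B C by rewrite -expr2 exprn_even_gt0.
have c0 P1 P2 : cross P1 P2 P1 = 0 by rewrite /cross; ring.
have c1 P1 P2 : cross P1 P2 P2 = 0 by rewrite /cross; ring.
have cA : cross B C A = area A B C by rewrite /area /cross; ring.
have cB : cross C A B = area A B C by rewrite /area /cross; ring.
have cC : cross A B C = area A B C by [].
move=> H [[|]|] [t /andP [t0 t1] e]; case: H; rewrite /inside /outside /= e !crs !c0 !c1 ?cA ?cB ?cC.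
all: case; nra.
Qed.
Lemma cross_seg P1 P2 A B t :
  cross P1 P2 (seg A B t) = (1 - t) * cross P1 P2 A + t * cross P1 P2 B.
Proof. by rewrite /cross /seg /=; ring. Qed.

Lemma closure_seg (U : set plane) X P :
  (forall t, 0 < t <= 1 -> U (seg X P t)) -> closure U X.
Proof.
move=> UX V; rewrite -{1}(seg0 X P) => /(@seg_continuous X P 0) /nbhs_ballP [e /= e0 eV].
have m0 : 0 < Num.min (e / 2) 1 by rewrite lt_min divr_gt0 // ltr01.
exists (seg X P (Num.min (e / 2) 1)); split; first by apply: UX; rewrite m0 ge_min lexx orbT.
apply: eV; rewrite /ball /= sub0r normrN gtr0_norm //.
by rewrite gt_min ltr_pdivrMr // ltr_pMr // ltr1n.
Qed.

Lemma triangle_closure_inside A B C : area A B C != 0 ->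
  triangle A B C `<=` closure (inside A B C).
Proof.
move=> D0 X XT.
have DD : 0 < area A B C * area A B C by rewrite -expr2 exprn_even_gt0.
have c0 P1 P2 : cross P1 P2 P1 = 0 by rewrite /cross; ring.
have c1 P1 P2 : cross P1 P2 P2 = 0 by rewrite /cross; ring.
have cA : cross B C A = area A B C by rewrite /area /cross; ring.
have cB : cross C A B = area A B C by rewrite /area /cross; ring.
have cC : cross A B C = area A B C by [].
have [h1 h2 h3] : [/\ 0 <= area A B C * cross B C X, 0 <= area A B C * cross C A X
    & 0 <= area A B C * cross A B X].
  by case: XT => [[|]|] [t /andP [t0 t1] ->]; rewrite !cross_seg !c0 !c1 ?cA ?cB ?cC; split; nra.
(* Moving towards the centroid makes all three barycentric coordinates positive at once. *)
apply: (@closure_seg _ _ ((A.1 + B.1 + C.1) / 3, (A.2 + B.2 + C.2) / 3)) => t /andP [t0 t1].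
have ce : [/\ cross B C ((A.1 + B.1 + C.1) / 3, (A.2 + B.2 + C.2) / 3) = area A B C / 3,
    cross C A ((A.1 + B.1 + C.1) / 3, (A.2 + B.2 + C.2) / 3) = area A B C / 3 &
    cross A B ((A.1 + B.1 + C.1) / 3, (A.2 + B.2 + C.2) / 3) = area A B C / 3].
  by rewrite /area /cross /=; split; field.
by case: ce => e1 e2 e3; rewrite /inside /= !cross_seg e1 e2 e3; split; nra.
Qed.

Lemma triangle_closure_outside A B C : area A B C != 0 ->
  triangle A B C `<=` closure (outside A B C).
Proof.
move=> D0 X XT.
have DD : 0 < area A B C * area A B C by rewrite -expr2 exprn_even_gt0.
have c0 P1 P2 : cross P1 P2 P1 = 0 by rewrite /cross; ring.
have c1 P1 P2 : cross P1 P2 P2 = 0 by rewrite /cross; ring.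
(* The reflection of the centroid in [X]: moving towards it leaves the triangle through the side
   that contains [X]. *)
pose P : plane := (2 * X.1 - (A.1 + B.1 + C.1) / 3, 2 * X.2 - (A.2 + B.2 + C.2) / 3).
have [e1 e2 e3] : [/\ cross B C P = 2 * cross B C X - area A B C / 3,
    cross C A P = 2 * cross C A X - area A B C / 3 &
    cross A B P = 2 * cross A B X - area A B C / 3].
  by rewrite /P /area /cross /=; split; field.
apply: (@closure_seg _ _ P) => t /andP [t0 t1].
have neg : area A B C * (t * (- (area A B C / 3))) < 0.
  have := mulr_gt0 t0 DD; lra.
rewrite /outside /= !cross_seg e1 e2 e3.
case: XT => [[|]|] [u _ ->]; rewrite !cross_seg !c0 !c1 ?(mulr0, addr0, add0r, sub0r).
- by constructor 3.
- by constructor 1.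
- by constructor 2.
Qed.

Lemma seg_neq A B t : 0 <= t <= 1 -> seg A B t <> A -> seg A B t <> B -> 0 < t < 1.
Proof.
move=> /andP [t0 t1] nA nB; rewrite !lt_neqAle t0 t1 !andbT.
by apply/andP; split; apply/eqP => e; [apply: nA; rewrite -e seg0|apply: nB; rewrite e seg1].
Qed.

(** At an inner point of the side [A B] the other two barycentric coordinates are positive, and they
    remain so nearby; hence the sign of [cross A B] alone decides. *)
Lemma near_edge A B C X : area A B C != 0 -> segment A B X -> X <> A -> X <> B ->
  \forall Y \near X, [/\ 0 < area A B C * cross A B Y -> inside A B C Y,
    cross A B Y = 0 -> segment A B Y & area A B C * cross A B Y < 0 -> outside A B C Y].
Proof.
move=> D0 [t t01 e] nA nB; have /andP [t0 t1] : 0 < t < 1.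
  by apply: (@seg_neq A B) => //; rewrite -e.
have DD : 0 < area A B C * area A B C by rewrite -expr2 exprn_even_gt0.
have [a [b [c H1]]] := cross_half (area A B C) B C.
have [a' [b' [c' H2]]] := cross_half (area A B C) C A.
have n1 : nbhs X (half a b c).
  apply: open_nbhs_nbhs; split; first exact: half_open.
  rewrite /half /= -H1 e cross_seg; have -> : cross B C B = 0 by rewrite /cross; ring.
  have -> : cross B C A = area A B C by rewrite /area /cross; ring.
  nra.
have n2 : nbhs X (half a' b' c').
  apply: open_nbhs_nbhs; split; first exact: half_open.
  rewrite /half /= -H2 e cross_seg; have -> : cross C A A = 0 by rewrite /cross; ring.
  have -> : cross C A B = area A B C by rewrite /area /cross; ring.
  nra.
near=> Y; have h1 : half a b c Y by near: Y.
have h2 : half a' b' c' Y by near: Y.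
rewrite /half /= -H1 in h1; rewrite /half /= -H2 in h2; split=> // h3.
  by apply: (@on_segment _ _ C) => //; exact: ltW.
by constructor 3.
Unshelve. all: by end_near. Qed.
End Triangle.

(** * The two sides of a triangle *)

Section Faces.
Variable R : realType.
Local Notation plane := (plane R).
Local Notation Q := (@Q R).
Implicit Types (A B C X Y : plane).

(** The conclusion of the Jordan curve theorem for [K], in a form that homeomorphisms transport. *)
Definition divides (K F G : set plane) : Prop :=
  [/\ open F /\ open G, ~` K = F `|` G, F `&` G = set0, connected F /\ connected G
    & K `<=` closure F /\ K `<=` closure G].

Lemma dividesC K F G : divides K F G -> divides K G F.
Proof. by case=> [[? ?] ? ? [? ?] [? ?]]; split; rewrite 1?setUC 1?setIC. Qed.

Lemma triangle_divides A B C : area A B C != 0 ->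
  divides (triangle A B C) (inside A B C) (outside A B C).
Proof.
move=> D0; split.
- by split; [exact: inside_open|exact: outside_open].
- exact: triangle_compl.
- apply/seteqP; split=> // X [[h1 h2 h3] [h|h|h]].
  + by have := lt_trans h h1; rewrite ltxx.
  + by have := lt_trans h h2; rewrite ltxx.
  + by have := lt_trans h h3; rewrite ltxx.
- by split; [exact: inside_connected|exact: outside_connected].
- by split; [exact: triangle_closure_inside|exact: triangle_closure_outside].
Qed.

Lemma cross_swap A B X : cross A B X = - cross B A X.
Proof. by rewrite /cross; ring. Qed.

Lemma inside_rot A B C : inside A B C = inside B C A.
Proof.
by apply/seteqP; split=> X; rewrite /inside /= (area_rot A B C); case.
Qed.

Lemma outside_rot A B C : outside A B C = outside B C A.
Proof.
by apply/seteqP; split=> X; rewrite /outside /= (area_rot A B C); case;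
  by [constructor 1|constructor 2|constructor 3].
Qed.

Lemma inside_swap A B C : inside A B C = inside B A C.
Proof.
have e : area A B C = - area B A C by rewrite /area /cross; ring.
by apply/seteqP; split=> X; rewrite /inside /= e (cross_swap B C) (cross_swap C A)
  (cross_swap A B) !mulrNN; case.
Qed.

Lemma outside_swap A B C : outside A B C = outside B A C.
Proof.
have e : area A B C = - area B A C by rewrite /area /cross; ring.
by apply/seteqP; split=> X; rewrite /outside /= e (cross_swap B C) (cross_swap C A)
  (cross_swap A B) !mulrNN; case; by [constructor 1|constructor 2|constructor 3].
Qed.

Lemma triangle_rot A B C : triangle A B C = triangle B C A.
Proof. by rewrite /triangle -setUA setUC. Qed.

Lemma triangle_swap A B C : triangle A B C = triangle B A C.
Proof.
by rewrite /triangle (segmentC B A) (segmentC A C) (segmentC C B) setUAC.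
Qed.

(** [C] and [C'] lie on opposite sides of the line [A B], so the two triangles fill both sides of
    the edge. *)
Lemma near_inside2 A B C C' X : area A B C * area A B C' < 0 -> segment A B X ->
  X <> A -> X <> B ->
  nbhs X (segment A B `|` inside A B C `|` inside A B C').
Proof.
move=> DD sX XA XB; have D0 : area A B C != 0 by apply/eqP => e; move: DD; rewrite e mul0r ltxx.
have D0' : area A B C' != 0 by apply/eqP => e; move: DD; rewrite e mulr0 ltxx.
near=> Y.
have [i1 i2 i3] : [/\ 0 < area A B C * cross A B Y -> inside A B C Y,
    cross A B Y = 0 -> segment A B Y & area A B C * cross A B Y < 0 -> outside A B C Y].
  by near: Y; exact: near_edge.
have [j1 j2 j3] : [/\ 0 < area A B C' * cross A B Y -> inside A B C' Y,
    cross A B Y = 0 -> segment A B Y & area A B C' * cross A B Y < 0 -> outside A B C' Y].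
  by near: Y; exact: near_edge.
have [c0|c0|/esym c0] := ltgtP 0 (cross A B Y); last by left; left; exact: i2.
  have [d0|d0|e] := ltgtP 0 (area A B C); last by have := D0; rewrite -e eqxx.
    by left; right; apply: i1; rewrite mulr_gt0.
  by right; apply: j1; rewrite mulr_gt0 // -(nmulr_rlt0 _ d0).
have [d0|d0|e] := ltgtP 0 (area A B C); last by have := D0; rewrite -e eqxx.
  by right; apply: j1; rewrite nmulr_rgt0 // -(pmulr_rlt0 _ d0).
by left; right; apply: i1; rewrite nmulr_rgt0.
Unshelve. all: by end_near. Qed.

(** [C] and [C'] lie on the same side of the line [A B], and the opposite side belongs to
    [outside A B C]. This is the case of an edge of the outer face. *)
Lemma near_outside2 A B C C' X : 0 < area A B C * area A B C' -> segment A B X ->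
  X <> A -> X <> B ->
  nbhs X (segment A B `|` outside A B C `|` inside A B C').
Proof.
move=> DD sX XA XB; have D0 : area A B C != 0 by apply/eqP => e; move: DD; rewrite e mul0r ltxx.
have D0' : area A B C' != 0 by apply/eqP => e; move: DD; rewrite e mulr0 ltxx.
near=> Y.
have [i1 i2 i3] : [/\ 0 < area A B C * cross A B Y -> inside A B C Y,
    cross A B Y = 0 -> segment A B Y & area A B C * cross A B Y < 0 -> outside A B C Y].
  by near: Y; exact: near_edge.
have [j1 j2 j3] : [/\ 0 < area A B C' * cross A B Y -> inside A B C' Y,
    cross A B Y = 0 -> segment A B Y & area A B C' * cross A B Y < 0 -> outside A B C' Y].
  by near: Y; exact: near_edge.
have [c0|c0|/esym c0] := ltgtP 0 (cross A B Y); last by left; left; exact: i2.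
  have [d0|d0|e] := ltgtP 0 (area A B C); last by have := D0; rewrite -e eqxx.
    by right; apply: j1; rewrite mulr_gt0 // -(pmulr_rgt0 _ d0).
  by left; right; apply: i3; rewrite nmulr_rlt0.
have [d0|d0|e] := ltgtP 0 (area A B C); last by have := D0; rewrite -e eqxx.
  by left; right; apply: i3; rewrite pmulr_rlt0.
by right; apply: j1; rewrite nmulr_rgt0 // -(nmulr_rgt0 _ d0).
Unshelve. all: by end_near. Qed.

(* [p], [p'] are the poles and [u], [v], [t] the equator of the canonical drawing. *)
Definition roles (p p' u v t : nat) : bool :=
  [&& p \in [:: 0; 4], p' \in [:: 0; 4], p != p', uniq [:: u; v; t]
    & all (fun i => 0 < i < 4) [:: u; v; t]]%N.

Lemma roles_ind (P : nat -> nat -> nat -> nat -> nat -> Prop) :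
  (P 0 4 1 2 3 -> P 0 4 1 3 2 -> P 0 4 2 1 3 -> P 0 4 2 3 1 -> P 0 4 3 1 2 ->
  P 0 4 3 2 1 -> P 4 0 1 2 3 -> P 4 0 1 3 2 -> P 4 0 2 1 3 -> P 4 0 2 3 1 ->
  P 4 0 3 1 2 -> P 4 0 3 2 1 ->
  forall p p' u v t, roles p p' u v t -> P p p' u v t)%N.
Proof.
move=> ? ? ? ? ? ? ? ? ? ? ? ? p p' u v t.
case/and5P; rewrite !inE => /orP [] /eqP -> /orP [] /eqP -> // _.
all: by case: u v t => [|[|[|[|u]]]] [|[|[|[|v]]]] [|[|[|[|t]]]] // _; rewrite /= ?andbF.
Qed.

(** An integer copy of [five]: it lets the tactic [signs] settle sign conditions at the five points
    by computation. *)
Definition Zfive (i : nat) : int * int :=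
  nth (0, 0) [:: (0, 0); (5, 0); (0, 5); (1, 1); (3, 1)] i.
Definition Zcross (i j k : nat) : int :=
  let: (a, b) := Zfive i in let: (a', b') := Zfive j in let: (x, y) := Zfive k in
  (a' - a) * (y - b) - (b' - b) * (x - a).

Lemma crossQ i j k : cross (Q i) (Q j) (Q k) = (Zcross i j k)%:~R.
Proof.
have QE l : Q l = ((Zfive l).1%:~R, (Zfive l).2%:~R).
  by case: l => [|[|[|[|[|l]]]]] //; rewrite /Q /straight /Zfive /= !nth_nil.
rewrite /cross !QE /Zcross; case: (Zfive i) (Zfive j) (Zfive k) => a b [a' b'] [x y] /=.
by rewrite -!rmorphB -!rmorphM -rmorphB.
Qed.
End Faces.

Ltac coords := rewrite /area /cross /Q /straight /=.

Ltac signs := rewrite /area !crossQ -?intrM ?ltr0z ?ltrz0 ?intr_eq0; vm_compute; reflexivity.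

(** * Faces of the canonical drawing *)

Section CanonicalFaces.
Variable R : realType.
Local Notation plane := (plane R).
Local Notation Q := (@Q R).
Implicit Types (X Y : plane).

(** For two equatorial vertices, [u + v == 3] means 1 and 2. The face 0 1 2 is the unbounded one,
    and only this face is the outside of its triangle. *)
Definition outer_face (p u v : nat) : bool := (p == 0)%N && (u + v == 3)%N.
Definition flat_face (p u v : nat) : set plane :=
  if outer_face p u v then outside (Q p) (Q u) (Q v) else inside (Q p) (Q u) (Q v).
Definition coface (p u v : nat) : set plane :=
  if outer_face p u v then inside (Q p) (Q u) (Q v) else outside (Q p) (Q u) (Q v).
Definition polar_side (p : nat) : set plane :=
  if (p == 0)%N then outside (Q 1) (Q 2) (Q 3) else inside (Q 1) (Q 2) (Q 3).

Lemma area_roles p p' u v t : roles p p' u v t -> area (Q p) (Q u) (Q v) != 0.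
Proof. by move: p p' u v t; apply: roles_ind; signs. Qed.

Lemma face_divides p p' u v t : roles p p' u v t ->
  divides (triangle (Q p) (Q u) (Q v)) (flat_face p u v) (coface p u v).
Proof.
move=> /area_roles D; have H := triangle_divides D.
by rewrite /flat_face /coface; case: ifP => // _; exact: dividesC.
Qed.

Lemma equator_divides p p' u v t : roles p p' u v t ->
  divides (triangle (Q u) (Q v) (Q t)) (polar_side p) (polar_side p').
Proof.
have D : area (Q 1) (Q 2) (Q 3) != 0 by signs.
have := triangle_divides D; set T := triangle _ _ _ => H r.
have -> : triangle (Q u) (Q v) (Q t) = T.
  move: p p' u v t r; apply: roles_ind => //; rewrite /T;
  by [|rewrite [LHS]triangle_rot|rewrite [RHS]triangle_rot|rewrite [LHS]triangle_swap
     |rewrite [LHS]triangle_swap [LHS]triangle_rot|rewrite [LHS]triangle_swap [RHS]triangle_rot].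
by move: p p' u v t r; apply: roles_ind; rewrite /polar_side //=; exact: dividesC.
Qed.

Lemma vertex_coface p p' u v t : roles p p' u v t ->
  coface p u v (Q t) /\ coface p u v (Q p').
Proof.
by move: p p' u v t; apply: roles_ind; rewrite /coface /outside /inside /=;
  split; first [split; signs|constructor 1; signs|constructor 2; signs|constructor 3; signs].
Qed.

Lemma polar_side_vertex p p' u v t : roles p p' u v t -> polar_side p (Q p).
Proof.
by move: p p' u v t; apply: roles_ind; rewrite /polar_side /outside /inside /=;
  first [split; signs|constructor 1; signs|constructor 2; signs|constructor 3; signs].
Qed.

Lemma outside_or A B C X : outside A B C X \/
  [/\ 0 <= area A B C * cross B C X, 0 <= area A B C * cross C A X
    & 0 <= area A B C * cross A B X].
Proof.
have [|n] := pselect (outside A B C X); [by left|right].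
by split; rewrite leNgt; apply/negP => h; apply: n; [constructor 1|constructor 2|constructor 3].
Qed.

Lemma face_polar_side p p' u v t : roles p p' u v t -> flat_face p u v `<=` polar_side p.
Proof.
move: p p' u v t; apply: roles_ind; rewrite /polar_side /flat_face /= => X.
all: try by rewrite /inside /=; coords; case=> *; split; lra.
all: move=> H; have [//|n] := outside_or (Q 1) (Q 2) (Q 3) X; exfalso; move: H n;
  rewrite /outside /inside /=; coords;
  first [by move=> [? ? ?] [? ? ?]; lra|by move=> [?|?|?] [? ? ?]; lra].
Qed.

Lemma inside_segment A B C P P' X : inside A B C X -> segment P P' X ->
  ~ [\/ area A B C * cross B C P <= 0 /\ area A B C * cross B C P' <= 0,
      area A B C * cross C A P <= 0 /\ area A B C * cross C A P' <= 0
    | area A B C * cross A B P <= 0 /\ area A B C * cross A B P' <= 0].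
Proof.
case=> h1 h2 h3 [t /andP [t0 t1] e]; rewrite e !cross_seg in h1 h2 h3.
by case=> -[k k']; nra.
Qed.

Lemma outside_segment A B C P P' X : outside A B C X -> segment P P' X ->
  ~ [/\ 0 <= area A B C * cross B C P /\ 0 <= area A B C * cross B C P',
      0 <= area A B C * cross C A P /\ 0 <= area A B C * cross C A P'
    & 0 <= area A B C * cross A B P /\ 0 <= area A B C * cross A B P'].
Proof.
move=> h [t /andP [t0 t1] e] [[? ?] [? ?] [? ?]]; rewrite e in h.
by case: h; rewrite cross_seg; nra.
Qed.

(** For most edges a single side of the triangle suffices: a bounded face lies strictly on one side
    of that line and both ends of the edge do not; for the outer face, both ends lie in the closed
    triangle. *)
Lemma face_edge p p' u v t i j X : roles p p' u v t -> (i < j < 5)%N ->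
  (i, j) != (0, 4)%N -> flat_face p u v X -> segment (Q i) (Q j) X -> False.
Proof.
move=> H ij; move: i j ij p p' u v t H; apply: lt5_ind2 => //; apply: roles_ind => _;
  rewrite /flat_face /= => h s;
  first [solve [(apply: (outside_segment h s) || apply: (inside_segment h s));
    rewrite /area !crossQ -!intrM !(lerz0, ler0z);
    first [by split; split; vm_compute|by constructor 1; split; vm_compute
          |by constructor 2; split; vm_compute|by constructor 3; split; vm_compute]]
  (* No single side separates some edges, such as 0 2, from some faces, such as 4 1 3; the three
     inequalities together are then contradictory. *)
  |move: h s; rewrite /inside /=; coords => -[h1 h2 h3] [r /andP [r0 r1] e];
    rewrite e /seg /= in h1 h2 h3; lra].
Qed.

Lemma near_equator p p' u v t X : roles p p' u v t -> segment (Q u) (Q v) X ->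
  X <> Q u -> X <> Q v ->
  nbhs X (segment (Q u) (Q v) `|` flat_face p u v `|` flat_face p' u v).
Proof.
move=> r sX Xu Xv.
rewrite /flat_face !(inside_rot (Q _) (Q u) (Q v)) !(outside_rot (Q _) (Q u) (Q v)).
move: p p' u v t r sX Xu Xv; apply: roles_ind => sX Xu Xv; rewrite /outer_face /=.
all: try by apply: near_inside2 => //; signs.
all: try by apply: near_outside2 => //; signs.
all: by rewrite setUAC; apply: near_outside2 => //; signs.
Qed.

Lemma near_meridian p p' u v t X : roles p p' u v t -> segment (Q p) (Q u) X ->
  X <> Q p -> X <> Q u ->
  nbhs X (segment (Q p) (Q u) `|` flat_face p u v `|` flat_face p u t).
Proof.
move: p p' u v t; apply: roles_ind => sX Xu Xv; rewrite /flat_face /outer_face /=.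
all: try by apply: near_inside2 => //; signs.
all: try by apply: near_outside2 => //; signs.
all: by rewrite setUAC; apply: near_outside2 => //; signs.
Qed.
End CanonicalFaces.

(** * Faces of drawings *)

Section Separation.
Variable R : realType.
Local Notation plane := (plane R).
Implicit Types (A B C F G K U Z : set plane) (p q : plane).

Lemma open_separated U V : open U -> open V -> U `&` V = set0 -> @separated plane U V.
Proof.
have H A B : open B -> A `&` B = set0 -> closure A `&` B = set0.
  move=> oB AB; apply/seteqP; split=> // p [cA Bp].
  have [|q [Aq Bq]] := cA B; first exact: open_nbhs_nbhs.
  by have : (A `&` B) q by []; rewrite AB.
by move=> oU oV UV; split; [rewrite H|rewrite setIC H // setIC].
Qed.

Lemma connected_in_side U V C p : open U -> open V -> U `&` V = set0 ->
  connected C -> C `<=` U `|` V -> C p -> U p -> C `<=` U.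
Proof.
move=> oU oV UV cC CUV Cp Up.
have [//|CV] := connected_subset (open_separated oU oV UV) CUV cC.
have : (U `&` V) p by split=> //; exact: CV.
by rewrite UV.
Qed.

Lemma connected_adjoin C q : connected C -> closure C q -> connected (C `|` [set q]).
Proof.
move=> cC clq; apply/connectedP => E [E0 CE sE].
have [sE1 sE2] : closure (E false) `&` E true = set0 /\ E false `&` closure (E true) = set0 by [].
have H b : C `<=` E b -> False.
  move=> Cb; have [r Er] := E0 (~~ b).
  have rq : r = q.
    have : (C `|` [set q]) r by rewrite CE; case: b {Cb} Er; [left|right].
    case=> // /Cb Ebr; case: b Cb Er Ebr => Cb Er Ebr.
      have : (closure (E false) `&` E true) r by split=> //; exact: subset_closure.
      by rewrite sE1.
    have : (closure (E false) `&` E true) r by split=> //; exact: subset_closure.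
    by rewrite sE1.
  rewrite {r}rq in Er.
  have clE : closure (E b) q by exact: closureS Cb _ clq.
  case: b Cb Er clE => Cb Er clE.
    by have : (E false `&` closure (E true)) q by []; rewrite sE2.
  by have : (closure (E false) `&` E true) q by []; rewrite sE1.
have CE' : C `<=` E false `|` E true by rewrite -CE; left.
by have [] := connected_subset sE CE' cC; exact: H.
Qed.

(** The outer bound for faces: drawing more than [K] can only cut the side [F] into smaller
    pieces. *)
Lemma divides_side K F G Z p : divides K F G -> K `<=` Z -> F p ->
  connected_component (~` Z) p `<=` F.
Proof.
case=> [[oF oG] KFG FG _ _] KZ Fp.
have [Zp|nZ] := pselect (Z p); first by rewrite connected_component_out //; exact.
apply: (connected_in_side oF oG FG (@component_connected _ _ _) _ _ Fp).
  by rewrite -KFG => q /connected_component_sub nq /KZ.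
exact: connected_component_refl.
Qed.

(** The inner bound for faces. Only [closure F q] is required, because [q] will be a corner of [F],
    namely the free position, or an inner point of an arc that is not drawn. *)
Lemma component_reach Z F q : connected F -> F `<=` ~` Z -> closure F q -> ~ Z q ->
  F `<=` connected_component (~` Z) q.
Proof.
move=> cF FZ clq nZ p Fp; exists (F `|` [set q]); last by left.
by rewrite /=; split; [right|move=> r [/FZ|->]|exact: connected_adjoin].
Qed.

(** [G] and [G'] are connected, avoid [K] and share [q], so each contains the other; then the
    remaining sides agree as well. *)
Lemma divides_unique K F G F' G' q : divides K F G -> divides K F' G' ->
  G q -> G' q -> F = F'.
Proof.
move=> [[oF oG] KFG FG [cF cG] _] [[oF' oG'] KFG' FG' [cF' cG'] _] Gq G'q.
have GF : G `&` F = set0 by rewrite setIC.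
have GF' : G' `&` F' = set0 by rewrite setIC.
have sub : G' `<=` G.
  by apply: (connected_in_side oG oF GF cG' _ G'q Gq); rewrite setUC -KFG KFG' => r; right.
have sub' : G `<=` G'.
  by apply: (connected_in_side oG' oF' GF' cG _ Gq G'q); rewrite setUC -KFG' KFG => r; right.
apply/seteqP; split=> r Fr.
  have : (F' `|` G') r by rewrite -KFG' KFG; left.
  case=> // /sub Gr; have : (F `&` G) r by []; by rewrite FG.
have : (F `|` G) r by rewrite -KFG KFG'; left.
by case=> // /sub' Gr; have : (F' `&` G') r by []; rewrite FG'.
Qed.

End Separation.

(** * Homeomorphic copies of the canonical drawing *)

Section States.
Variable R : realType.
Local Notation plane := (plane R).
Local Notation Q := (@Q R).
Local Notation homeo := (homeo R).

Lemma segment_shared (A B C X : plane) : area A B C != 0 ->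
  segment A B X -> segment A C X -> X = A.
Proof.
move=> D0 [t _ e] [r _ e']; have : cross A C X = 0.
  by rewrite e' /cross /seg /=; ring.
rewrite {1}e cross_seg; have -> : cross A C A = 0 by rewrite /cross; ring.
have -> : cross A C B = - area A B C by rewrite /area /cross; ring.
rewrite mulr0 add0r => /eqP; rewrite mulrN oppr_eq0 mulf_eq0 (negPf D0) orbF => /eqP t0.
by rewrite e t0 seg0.
Qed.

Lemma segment_apart (A B C D X : plane) : 0 < area A B C * area A B D ->
  segment A B X -> segment C D X -> False.
Proof.
move=> D0 [t _ e] [r /andP [r0 r1] e']; have : cross A B X = 0.
  by rewrite e /cross /seg /=; ring.
rewrite e' cross_seg; rewrite /area in D0 => H.
have H2 := congr1 (fun z => z * cross A B C) H; rewrite mul0r in H2.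
have : 0 <= cross A B C ^+ 2 by exact: sqr_ge0.
have [r1'|r1'] := eqVneq r 1.
  rewrite r1' in H; have : cross A B D = 0 by lra.
  by move=> e0; rewrite e0 mulr0 ltxx in D0.
have r1'' : r < 1 by rewrite lt_neqAle r1'.
have [r0'|r0'] := eqVneq r 0.
  rewrite r0' in H; have : cross A B C = 0 by lra.
  by move=> e0; rewrite e0 mul0r ltxx in D0.
have r0'' : 0 < r by rewrite lt_def r0'.
have := mulr_gt0 r0'' D0; nra.
Qed.

Lemma Q_noncollinear i j k : (i < 5)%N -> (j < 5)%N -> (k < 5)%N -> uniq [:: i; j; k] ->
  area (Q i) (Q j) (Q k) != 0.
Proof.
by case: i j k => [|[|[|[|[|i]]]]] [|[|[|[|[|j]]]]] [|[|[|[|[|k]]]]] // _ _ _ _; signs.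
Qed.

Lemma Q_apart i j k l : (i < 5)%N -> (j < 5)%N -> (k < 5)%N -> (l < 5)%N ->
  uniq [:: i; j; k; l] -> (i, j) \notin [:: (0, 4); (4, 0)]%N ->
  (k, l) \notin [:: (0, 4); (4, 0)]%N ->
  0 < area (Q i) (Q j) (Q k) * area (Q i) (Q j) (Q l) \/
  0 < area (Q k) (Q l) (Q i) * area (Q k) (Q l) (Q j).
Proof.
case: i j k l => [|[|[|[|[|i]]]]] [|[|[|[|[|j]]]]] [|[|[|[|[|k]]]]] [|[|[|[|[|l]]]]] //.
all: move=> _ _ _ _ _ // _ //; first [by left; signs|by right; signs].
Qed.

Lemma Q_inj i j : (i < 5)%N -> (j < 5)%N -> Q i = Q j -> i = j.
Proof.
move=> i5 j5 e; move: (congr1 fst e) (congr1 snd e) => {e}; move: i j i5 j5.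
by move=> [|[|[|[|[|i]]]]] [|[|[|[|[|j]]]]] // _ _; rewrite /Q /straight /= => *; exfalso; lra.
Qed.

Lemma Q_vertex i j k : (i < 5)%N -> (j < 5)%N -> (k < 5)%N -> i != j ->
  segment (Q i) (Q j) (Q k) -> k = i \/ k = j.
Proof.
move=> i5 j5 k5 ij s; have [->|ki] := eqVneq k i; [by left|].
have [->|kj] := eqVneq k j; [by right|exfalso].
have := @Q_noncollinear i j k i5 j5 k5; rewrite /= !inE !negb_or ij !(eq_sym _ k) ki kj.
move=> /(_ isT) /eqP; apply; case: s => t _ ->.
by rewrite /area /cross /seg /=; ring.
Qed.

Lemma Q_planar i j k l X : (i < 5)%N -> (j < 5)%N -> (k < 5)%N -> (l < 5)%N ->
  i != j -> k != l -> (i, j) \notin [:: (0, 4); (4, 0)]%N ->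
  (k, l) \notin [:: (0, 4); (4, 0)]%N -> (k, l) \notin [:: (i, j); (j, i)] ->
  segment (Q i) (Q j) X -> segment (Q k) (Q l) X ->
  exists e, [/\ e \in [:: i; j], e \in [:: k; l] & X = Q e].
Proof.
move=> i5 j5 k5 l5 ij kl nij nkl; rewrite !inE !xpair_eqE negb_or => /andP [n1 n2] sij skl.
have shared a b c : (a < 5)%N -> (b < 5)%N -> (c < 5)%N -> a != b -> a != c -> b != c ->
    segment (Q a) (Q b) X -> segment (Q a) (Q c) X -> X = Q a.
  move=> a5 b5 c5 ab ac bc; apply: segment_shared; apply: Q_noncollinear => //.
  by rewrite /= !inE negb_or ab ac bc.
have [e|ik] := eqVneq i k; first subst k.
  exists i; rewrite !inE !eqxx; split=> //; apply: (shared i j l) => //.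
  by apply: contra n1 => /eqP ->; rewrite !eqxx.
have [e|il] := eqVneq i l; first subst l.
  exists i; rewrite !inE !eqxx orbT; split=> //; apply: (shared i j k) => //.
    by apply: contra n2 => /eqP ->; rewrite !eqxx.
  by rewrite segmentC.
have [e|jk] := eqVneq j k; first subst k.
  exists j; rewrite !inE !eqxx orbT; split=> //; apply: (shared j i l) => //.
    by rewrite eq_sym.
  by rewrite segmentC.
have [e|jl] := eqVneq j l; first subst l.
  exists j; rewrite !inE !eqxx !orbT; split=> //; apply: (shared j i k) => //.
  - by rewrite eq_sym.
  - by rewrite segmentC.
  - by rewrite segmentC.
exfalso; have [||] := Q_apart i5 j5 k5 l5 _ nij nkl.
- by rewrite /= !inE !negb_or ij ik il jk jl kl.
- by move=> D; exact: (segment_apart D sij skl).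
- by move=> D; exact: (segment_apart D skl sij).
Qed.

Lemma seg_inj (A B : plane) : A <> B -> injective (seg A B).
Proof.
move=> AB s t e; apply/eqP; rewrite -subr_eq0; apply/negPn/negP => st; apply: AB.
have z (a b : R) : (1 - s) * a + s * b = (1 - t) * a + t * b -> a = b.
  move=> h; apply/eqP; rewrite eq_sym -subr_eq0 -(mulrI_eq0 _ (mulfI st)).
  by apply/eqP; move: h; lra.
by case: A B e => a a' [b b'] e; rewrite (z a b (congr1 fst e)) (z a' b' (congr1 snd e)).
Qed.

(* The five positions in the plane are indexed by ['I_5]; position i plays the part
   of the point [Q (label i)] of the canonical drawing. *)
Record state := State {
  chart : homeo;
  label : 'I_5 -> nat;
  label_lt : forall i, (label i < 5)%N;
  label_inj : injective label }.

Implicit Types (st : state) (i j k : 'I_5) (X : plane).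

(** The image under the chart, written as a preimage under its inverse so that it commutes with set
    operations by conversion. *)
Definition carry st (U : set plane) : set plane := hinv (chart st) @^-1` U.

Lemma carryE st U : carry st U = chart st @` U.
Proof.
apply/seteqP; split=> X; rewrite /carry /preimage /=; last by case=> Y UY <-; rewrite hfunK.
by move=> UX; exists (hinv (chart st) X); rewrite ?hinvK.
Qed.

Lemma carry_open st U : open U -> open (carry st U).
Proof. by move=> oU; apply: open_comp => // X _; exact: hinv_cts. Qed.

Lemma carry_connected st U : connected U -> connected (carry st U).
Proof.
move=> cU; rewrite carryE; apply: connected_continuous_connected => //.
exact/continuous_subspaceT/hfun_cts.
Qed.

Lemma carry_closure st U V : U `<=` closure V -> carry st U `<=` closure (carry st V).
Proof.
move=> UV X /UV clX W nW; have [] := clX (chart st @^-1` W).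
  by apply: (@hfun_cts R (chart st)); rewrite hinvK.
by move=> Y [VY WY]; exists (chart st Y); split=> //; rewrite /carry /preimage /= hfunK.
Qed.

Lemma carry_divides st K F G :
  divides K F G -> divides (carry st K) (carry st F) (carry st G).
Proof.
case=> [[oF oG] KFG FG [cF cG] [clF clG]]; split.
- by split; exact: carry_open.
- by rewrite -[LHS]/(carry st (~` K)) KFG.
- by rewrite -[LHS]/(carry st (F `&` G)) FG.
- by split; exact: carry_connected.
- by split; exact: carry_closure.
Qed.

Lemma carry_near st X U : nbhs (hinv (chart st) X) U -> nbhs X (carry st U).
Proof. exact: hinv_cts. Qed.

Definition pt st i : plane := chart st (Q (label st i)).
Definition arc st i j : set plane := carry st (segment (Q (label st i)) (Q (label st j))).
(** The poles, whose [arc] is defined too but crosses the equator; the other arcs meet only at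
    common ends ([arc_planar]). *)
Definition polar st i j : bool := (label st i, label st j) \in [:: (0, 4); (4, 0)]%N.

Lemma arcC st i j : arc st i j = arc st j i.
Proof. by rewrite /arc segmentC. Qed.

Lemma polarC st i j : polar st i j = polar st j i.
Proof. by rewrite /polar !inE !xpair_eqE orbC ![(label st j == _) && _]andbC. Qed.

Lemma arcE st i j X : arc st i j X <-> segment (Q (label st i)) (Q (label st j)) (hinv (chart st) X).
Proof. by []. Qed.

Lemma pt_inv st i : hinv (chart st) (pt st i) = Q (label st i).
Proof. by rewrite /pt hfunK. Qed.

Lemma pt_eq st i X : hinv (chart st) X = Q (label st i) -> X = pt st i.
Proof. by move=> e; rewrite /pt -e hinvK. Qed.

Lemma label_neq st i j : i != j -> label st i != label st j.
Proof. by apply: contra => /eqP /label_inj ->. Qed.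

Lemma arc_pt st i j k : i != j -> arc st i j (pt st k) -> k = i \/ k = j.
Proof.
move=> ij; rewrite arcE pt_inv => s.
by have [/label_inj|/label_inj] := Q_vertex (label_lt st i) (label_lt st j)
  (label_lt st k) (label_neq st ij) s; [left|right].
Qed.

Lemma arc_l st i j : arc st i j (pt st i).
Proof. by rewrite arcE pt_inv; exists 0; rewrite ?seg0 // lexx ler01. Qed.

Lemma pt_inj st : injective (pt st).
Proof.
by move=> i j /(can_inj (@hfunK R (chart st))) /Q_inj e; apply/label_inj/e; exact: label_lt.
Qed.

Lemma arc_planar st i j k l X : i != j -> k != l -> ~~ polar st i j -> ~~ polar st k l ->
  [set k; l]%SET != [set i; j]%SET -> arc st i j X -> arc st k l X ->
  exists e, [/\ e \in [:: i; j], e \in [:: k; l] & X = pt st e].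
Proof.
move=> ij kl nij nkl ne; rewrite !arcE => s1 s2.
have [|e []] := Q_planar (label_lt st i) (label_lt st j) (label_lt st k) (label_lt st l)
  (label_neq st ij) (label_neq st kl) nij nkl _ s1 s2.
  rewrite !inE !xpair_eqE !(inj_eq (@label_inj st)).
  apply: contra ne => /orP [] /andP [/eqP -> /eqP ->] //; by rewrite finset.setUC.
by rewrite !inE => /orP [] /eqP -> h /pt_eq ->; [exists i|exists j]; split=> //;
  move: h; rewrite !inE ?eqxx ?orbT // !(inj_eq (@label_inj st)).
Qed.

Lemma arc_jordan st i j : i != j -> jordan_arc (pt st i) (pt st j) (arc st i j).
Proof.
move=> ij; exists (chart st \o seg (Q (label st i)) (Q (label st j))); split.
- apply: continuous_subspaceT => t; apply: continuous_comp; first exact: seg_continuous.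
  exact: hfun_cts.
- move=> s t _ _ /= /(can_inj (@hfunK R (chart st))).
  apply: seg_inj => /(@Q_inj _ _ (label_lt st i) (label_lt st j)) /label_inj e.
  by rewrite e eqxx in ij.
- by rewrite /= seg0.
- by rewrite /= seg1.
- rewrite /arc carryE; apply/seteqP; split=> X.
    by case=> Y [t t01 ->] <-; exists t; rewrite //= in_itv.
  by case=> t; rewrite /= in_itv => t01 <-; eexists; last by []; exists t.
Qed.

(** The homeomorphism of [canonical_flip] is put in front of the chart, and the labels are composed
    with [pi]. Two arcs are not controlled: the one between the old poles is newly drawn, and [k l]
    becomes the missing one. *)
Lemma flip st k l : k != l -> (0 < label st k < 4)%N -> (0 < label st l < 4)%N ->
  exists st', [/\ pt st' =1 pt st, polar st' k l &
    forall i j, i != j -> ~~ polar st i j -> [set i; j]%SET != [set k; l]%SET ->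
      arc st' i j = arc st i j].
Proof.
wlog kl : k l / (label st k < label st l)%N => [H|].
  have [/H //|lk|/label_inj ->] := ltngtP (label st k) (label st l); last by rewrite eqxx.
  rewrite eq_sym => nlk hk hl; have [st' [e p a]] := H l k lk nlk hl hk.
  by exists st'; split=> //; [rewrite polarC|move=> i j; rewrite (finset.setUC [set k]%SET); exact: a].
move=> _ /andP [k0 k4] /andP [l0 l4].
have [|h [pi [H piI pilt pik]]] := @canonical_flip R (label st k) (label st l) _ l4.
  by rewrite k0 kl.
pose lab i := pi (label st i).
have lab_lt i : (lab i < 5)%N by exact/pilt/label_lt.
have lab_inj : injective lab.
  by move=> i j /piI e; apply/label_inj/e; rewrite inE; exact: label_lt.
(* A vertex is fixed because it is an end of a carried edge: an equatorial vertex is paired with 0,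
   a pole with the equatorial vertex [label st k]. *)
have hQ (i : nat) : (i < 5)%N -> h (Q (pi i)) = Q i.
  move=> i5; pose j := if (0 < i < 4)%N then 0%N else label st k.
  have [nij j5 n1 n2] : [/\ i != j, (j < 5)%N,
      (i, j) \notin [:: (label st k, label st l); (0, 4)]%N &
      (j, i) \notin [:: (label st k, label st l); (0, 4)]%N].
    rewrite /j !inE !xpair_eqE; case: ifP => [/andP [i0 i4]|i04]; split; lia.
  have := carriesC H nij i5 j5 n1 n2 (t := 0); rewrite !seg0; apply.
  by rewrite lexx ler01.
exists (@State (homeo_comp (chart st) h) lab lab_lt lab_inj).
have arcs i j : i != j -> ~~ polar st i j -> [set i; j]%SET != [set k; l]%SET ->
    forall t, 0 <= t <= 1 -> h (seg (Q (lab i)) (Q (lab j)) t) =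
      seg (Q (label st i)) (Q (label st j)) t.
  move=> ij pij nkl; apply: (carriesC H); rewrite ?label_lt ?label_neq //.
    rewrite !inE negb_or; move: pij; rewrite /polar !inE negb_or => /andP [-> _]; rewrite andbT.
    apply: contra nkl; rewrite xpair_eqE !(inj_eq (@label_inj st)) => /andP [/eqP -> /eqP ->].
    by [].
  rewrite !inE negb_or; move: pij; rewrite polarC /polar !inE negb_or => /andP [-> _]; rewrite andbT.
  apply: contra nkl; rewrite xpair_eqE !(inj_eq (@label_inj st)) => /andP [/eqP -> /eqP ->].
  by rewrite finset.setUC.
split.
- by move=> i; rewrite /pt /= hQ // label_lt.
- by rewrite /polar /= /lab; case: pik => ->; rewrite !inE eqxx ?orbT.
move=> i j ij pij nkl; rewrite /arc !carryE /=; apply/seteqP; split=> X /= [Y [t t01 ->] <-].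
  by exists (seg (Q (label st i)) (Q (label st j)) t); [exists t|rewrite arcs].
by exists (seg (Q (lab i)) (Q (lab j)) t); [exists t|rewrite arcs].
Qed.

End States.

(** * Faces of a state *)

Section StateFaces.
Variable R : realType.
Local Notation plane := (plane R).
Local Notation Q := (@Q R).
Implicit Types (st : state R) (a x p u v t i j k : 'I_5) (X : plane).

Lemma face_vertex (p p' u v t k : nat) : roles p p' u v t -> (k < 5)%N -> ~ flat_face p u v (Q k).
Proof.
move=> r k5 f.
have s0 (A B : plane) : segment A B A by exists 0; rewrite ?seg0 // lexx ler01.
have s1 (A B : plane) : segment A B B by exists 1; rewrite ?seg1 // lexx ler01.
have ne (i j : nat) : (i < j < 5)%N -> (i, j) != (0, 4)%N -> k = i \/ k = j -> False.
  by move=> ij nij [e|e]; subst k; [have := s0 (Q i) (Q j)|have := s1 (Q i) (Q j)];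
     exact: (face_edge r ij nij f).
case: k k5 f ne => [|[|[|[|[|k]]]]] // _ _ ne.
- by apply: (ne 0 1)%N => //; left.
- by apply: (ne 0 1)%N => //; right.
- by apply: (ne 0 2)%N => //; right.
- by apply: (ne 0 3)%N => //; right.
- by apply: (ne 1 4)%N => //; right.
Qed.

Lemma face_swap (p u v : nat) : @flat_face R p u v = flat_face p v u.
Proof.
rewrite /flat_face /outer_face addnC; case: ifP => _.
  by rewrite outside_rot outside_swap -outside_rot.
by rewrite inside_rot inside_swap -inside_rot.
Qed.

Definition sroles st p p' u v t :=
  roles (label st p) (label st p') (label st u) (label st v) (label st t).

Lemma rolesC (p p' u v t : nat) : roles p p' u v t -> roles p' p u v t.
Proof. by rewrite /roles eq_sym => /and5P [-> -> -> -> ->]. Qed.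

Lemma roles_swap12 (p p' u v t : nat) : roles p p' u v t -> roles p p' v u t.
Proof. by move: p p' u v t; apply: roles_ind. Qed.

Lemma roles_swap23 (p p' u v t : nat) : roles p p' u v t -> roles p p' u t v.
Proof. by move: p p' u v t; apply: roles_ind. Qed.

Definition fc st p u v : set plane := carry st (flat_face (label st p) (label st u) (label st v)).
Definition cofc st p u v : set plane := carry st (coface (label st p) (label st u) (label st v)).
Definition tri st i j k : set plane := arc st i j `|` arc st j k `|` arc st k i.
Definition side st p : set plane := carry st (polar_side (label st p)).

Lemma fc_swap st p u v : fc st p u v = fc st p v u.
Proof. by rewrite /fc face_swap. Qed.

Variables (st : state R) (p p' u v t : 'I_5).
Hypothesis r : sroles st p p' u v t.

Lemma sroles_neq : [/\ p != p', p != u, p != v, p != t & p' != u] /\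
  [/\ p' != v, p' != t, u != v, u != t & v != t].
Proof.
rewrite -!(inj_eq (@label_inj _ st)); move: r; rewrite /sroles.
by move: (label st p) (label st p') (label st u) (label st v) (label st t); apply: roles_ind.
Qed.

Lemma sroles_polar : polar st p p'.
Proof.
by move: r; rewrite /sroles /polar; move: (label st p) (label st p') (label st u)
  (label st v) (label st t); apply: roles_ind.
Qed.

Lemma fc_divides : divides (tri st p u v) (fc st p u v) (cofc st p u v).
Proof. exact: (carry_divides st (face_divides R r)). Qed.

Lemma equator_sides : divides (tri st u v t) (side st p) (side st p').
Proof. exact: (carry_divides st (equator_divides R r)). Qed.

Lemma cofc_equator : cofc st p u v (pt st t).
Proof. by rewrite /cofc /carry /preimage /= pt_inv; case: (vertex_coface R r). Qed.

Lemma cofc_pole : cofc st p u v (pt st p').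
Proof. by rewrite /cofc /carry /preimage /= pt_inv; case: (vertex_coface R r). Qed.

Lemma side_pole : side st p (pt st p).
Proof. by rewrite /side /carry /preimage /= pt_inv; exact: (polar_side_vertex R r). Qed.

Lemma fc_side : fc st p u v `<=` side st p.
Proof. by move=> X; exact: (face_polar_side r). Qed.

Lemma fc_pt k : ~ fc st p u v (pt st k).
Proof. by rewrite /fc /carry /preimage /= pt_inv; apply: face_vertex r (label_lt st k). Qed.

Lemma fc_arc i j X : i != j -> ~~ polar st i j -> fc st p u v X -> arc st i j X -> False.
Proof.
wlog ij : i j / (label st i < label st j)%N => [H|_ nij].
  have [/H //|ji|/label_inj ->] := ltngtP (label st i) (label st j); last by rewrite eqxx.
  by rewrite eq_sym polarC arcC; exact: H.
apply: (face_edge r); first by rewrite ij label_lt.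
by apply: contra nij; rewrite /polar !inE => ->.
Qed.

Lemma near_equator_arc X : arc st u v X -> X <> pt st u -> X <> pt st v ->
  nbhs X (arc st u v `|` fc st p u v `|` fc st p' u v).
Proof.
move=> aX Xu Xv; apply: (carry_near (near_equator r aX _ _)).
  by move=> /pt_eq.
by move=> /pt_eq.
Qed.

Lemma near_meridian_arc X : arc st p u X -> X <> pt st p -> X <> pt st u ->
  nbhs X (arc st p u `|` fc st p u v `|` fc st p u t).
Proof.
move=> aX Xu Xv; apply: (carry_near (near_meridian r aX _ _)).
  by move=> /pt_eq.
by move=> /pt_eq.
Qed.

End StateFaces.

Section Drawn.
Variable R : realType.
Local Notation plane := (plane R).
Implicit Types (st : state R) (i j k : 'I_5) (X : plane).

Lemma equator_nonpolar st p p' u v t i j : sroles st p p' u v t ->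
  (i \in [:: u; v; t]) || (j \in [:: u; v; t]) -> ~~ polar st i j.
Proof.
move=> r H; have H' : (label st i \in map (label st) [:: u; v; t]) ||
    (label st j \in map (label st) [:: u; v; t]).
  by case/orP: H => h; rewrite (map_f _ h) ?orbT.
move: r H'; rewrite /sroles /polar /=; move: (label st p) (label st p') (label st u)
  (label st v) (label st t); apply: roles_ind;
by rewrite !inE !xpair_eqE; lia.
Qed.

Lemma fc_tri st p p' u v t i j k X : sroles st p p' u v t -> i != j -> j != k -> k != i ->
  ~~ polar st i j -> ~~ polar st j k -> ~~ polar st k i -> fc st p u v X ->
  ~ tri st i j k X.
Proof.
by move=> r ij jk ki nij njk nki fX [[|]|]; apply: (fc_arc r).
Qed.

(** If the faces met, connectedness would put [fc st p u t] inside [fc st p u v]; but it accumulates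
    at its corner [t], which is in the open other side. *)
Lemma fc_disjoint st p p' u v t : sroles st p p' u v t ->
  fc st p u v `&` fc st p u t = set0.
Proof.
move=> r; apply/seteqP; split=> // X [Xv Xt].
have r' : sroles st p p' u t v by exact: roles_swap23.
have [[oF oG] KFG FG [cF cG] [clF _]] := fc_divides r.
have [_ _ _ [cF' _] [clF' _]] := fc_divides r'.
have np i j := @equator_nonpolar st p p' u v t i j r.
have sub : fc st p u t `<=` fc st p u v.
  apply: (connected_in_side oF oG FG cF' _ Xt Xv) => Y Yt.
  have [[_ pu pv _ _] [_ _ uv _ _]] := sroles_neq r.
  by rewrite -KFG; apply: (fc_tri r') Yt; rewrite ?np ?inE ?eqxx ?orbT // eq_sym.
have cl : closure (fc st p u t) (pt st t).
  by apply: clF'; left; right; rewrite arcC; exact: arc_l.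
have [|Y [Yt Yc]] := cl (cofc st p u v).
  by apply: open_nbhs_nbhs; split=> //; exact: (cofc_equator r).
have : (fc st p u v `&` cofc st p u v) Y by split=> //; exact: sub.
by rewrite FG.
Qed.

(* The drawing restricted to the edges in [E]; [x] is the position that is free. *)
Definition drawn st (x : 'I_5) (E : rel 'I_5) : set plane :=
  [set X | (exists2 i, i != x & X = pt st i) \/
           (exists i j, [/\ i != x, j != x, i != j, E i j & arc st i j X])].

Lemma arc_middle st i j : i != j -> exists2 X, arc st i j X & forall k, X <> pt st k.
Proof.
move=> ij; have [g [_ gi g0 g1 E]] := arc_jordan st ij.
have H t : 0 <= t <= 1 -> arc st i j (g t).
  by move=> t01; rewrite E; exists t; rewrite //= in_itv.
have m01 : 0 <= (2^-1 : R) <= 1 by lra.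
have [z01 o01] : (0 <= (0 : R) <= 1) /\ (0 <= (1 : R) <= 1) by split; lra.
have I s t : 0 <= s <= 1 -> 0 <= t <= 1 -> g s = g t -> s = t.
  by move=> hs ht; apply: gi; rewrite inE /= in_itv.
exists (g 2^-1) => [|k e]; first exact: H.
have [ki|kj] : k = i \/ k = j by apply: (@arc_pt _ st _ _ _ ij); rewrite -e; exact: H.
  by have := I _ _ m01 z01; rewrite e ki -g0 => /(_ erefl); lra.
by have := I _ _ m01 o01; rewrite e kj -g1 => /(_ erefl); lra.
Qed.

(** If the free position is a pole, no drawn arc joins the poles, and the remaining arcs avoid every
    canonical face whatever [E] is. *)
Lemma fc_avoids st p p' u v t x E : sroles st p p' u v t -> x = p \/ x = p' ->
  fc st p u v `<=` ~` drawn st x E.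
Proof.
move=> r xp X fX [[i _ e]|[i [j [ix jx ij _ aX]]]].
  by apply: (fc_pt r (k := i)); rewrite -e.
apply: (fc_arc r ij _ fX aX); apply/negP => pij.
have : (x == i) || (x == j).
  have := sroles_polar r; move: pij; rewrite /polar !inE !xpair_eqE.
  rewrite -!(inj_eq (@label_inj _ st)).
  by case: xp => ->; case/orP=> /andP [/eqP -> /eqP ->];
    case/orP=> /andP [/eqP e1 /eqP e2]; rewrite ?e1 ?e2.
by case/orP => /eqP e; [rewrite e eqxx in ix|rewrite e eqxx in jx].
Qed.

Lemma middle_not_drawn st x E i j X : i != j -> ~~ polar st i j ->
  (forall k l, polar st k l -> (x == k) || (x == l)) -> symmetric E -> ~~ E i j ->
  arc st i j X -> (forall k, X <> pt st k) -> ~ drawn st x E X.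
Proof.
move=> ij pij px Es nE aX nX [[k _ /nX//]|[k [l [kx lx kl Ekl akl]]]].
have pkl : ~~ polar st k l.
  by apply/negP => /px /orP [] /eqP e; [rewrite e eqxx in kx|rewrite e eqxx in lx].
have ne : [set k; l]%SET != [set i; j]%SET.
  apply/negP => /eqP e; have : (k \in [set i; j]%SET) && (l \in [set i; j]%SET).
    by rewrite -e !inE !eqxx orbT.
  rewrite !inE => /andP [/orP [] /eqP ek /orP [] /eqP el]; subst k l.
  - by rewrite eqxx in kl.
  - by rewrite Ekl in nE.
  - by rewrite Es Ekl in nE.
  - by rewrite eqxx in kl.
by have [e [_ _ /nX]] := arc_planar ij kl pij pkl ne aX akl.
Qed.

End Drawn.

(** * Faces before ([st]) and after ([st2]) rerouting [z w] around the free position [x] *)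

Section RerouteFaces.
Variable R : realType.
Local Notation plane := (plane R).
Implicit Types (i j k : 'I_5) (X : plane).
Local Notation comp Z p := (connected_component (~` Z) p).

Lemma sroles_polarE (st : state R) p p' u v t k l : sroles st p p' u v t -> polar st k l ->
  (p' == k) || (p' == l).
Proof.
move=> r pkl; have [//|] := boolP ((p' == k) || (p' == l)); rewrite negb_or => /andP [nk nl].
have := sroles_polar r; move: pkl nk nl; rewrite /polar !inE !xpair_eqE.
rewrite -!(inj_eq (@label_inj _ st)).
by case/orP=> /andP [/eqP -> /eqP ->] + + /orP [] /andP [/eqP e1 /eqP e2]; rewrite e2.
Qed.

Variables (st st2 : state R) (a x y z w : 'I_5) (E : rel 'I_5).
Hypothesis r : sroles st a x y z w.
Hypothesis r2 : sroles st2 y x a z w.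
Hypothesis same_pt : pt st2 =1 pt st.
Hypothesis same_arc : forall i j, i != j -> i != x -> j != x ->
  [set i; j]%SET != [set z; w]%SET -> arc st2 i j = arc st i j.
Hypothesis Esym : symmetric E.
Hypotheses (Eyz : E y z) (Eyw : E y w) (Ezw : E z w).
Let Z := drawn st x E.
Let Z' := drawn st2 x E.

Lemma arc_drawn (s : state R) i j : i != x -> j != x -> i != j -> E i j -> arc s i j `<=` drawn s x E.
Proof. by move=> *; right; exists i, j; split. Qed.

Lemma pole_not_drawn (s : state R) p u v t : sroles s p x u v t -> ~ drawn s x E (pt s x).
Proof.
move=> rs [[i ix /pt_inj e]|[i [j [ix jx ij _ /(arc_pt ij)]]]].
  by rewrite e eqxx in ix.
by case=> e; [rewrite e eqxx in ix|rewrite e eqxx in jx].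
Qed.

Lemma tri_drawn (s : state R) i j k : i != x -> j != x -> k != x -> i != j -> j != k -> k != i ->
  E i j -> E j k -> E k i -> tri s i j k `<=` drawn s x E.
Proof. by move=> ix jx kx ij jk ki e1 e2 e3 X [[|]|]; apply: arc_drawn. Qed.

Lemma arc_in_closure (s : state R) p p' u v t C : sroles s p p' u v t ->
  fc s p u v `<=` C -> [/\ arc s p u `<=` closure C, arc s u v `<=` closure C
    & arc s v p `<=` closure C].
Proof.
move=> rs FC; have [_ _ _ _ [clF _]] := fc_divides rs.
have H X : tri s p u v X -> closure C X by move=> /clF; exact: closureS.
by split=> X aX; apply: H; [left; left|left; right|right].
Qed.

Lemma same_arcs : [/\ arc st2 y z = arc st y z, arc st2 y w = arc st y w,
  arc st2 a z = arc st a z, arc st2 a w = arc st a w & arc st2 a y = arc st a y].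
Proof.
have [[ax ay az aw xy] [xz xw yz yw zw]] := sroles_neq r.
have ne i j : i != z -> i != w -> [set i; j]%SET != [set z; w]%SET.
  move=> iz iw; apply/negP => /eqP e; have : i \in [set z; w]%SET by rewrite -e !inE eqxx.
  by rewrite !inE (negPf iz) (negPf iw).
by split; apply: same_arc; rewrite 1?ne // eq_sym.
Qed.

(* The face of [st] opposite to the rerouted edge survives in [st2]. *)
Lemma common_face : fc st a z y = fc st2 y z a.
Proof.
have ra : sroles st a x z y w by exact: roles_swap12.
have ry : sroles st2 y x z a w by exact: roles_swap12.
have T : tri st2 y z a = tri st a z y.
  have [e1 _ e2 _ e3] := same_arcs.
  rewrite /tri e1 [arc st2 z a]arcC e2 e3 [arc st z y]arcC [arc st y a]arcC.
  by rewrite [arc st y z `|` _]setUC.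
have D2 := fc_divides ry; rewrite T in D2.
apply: (divides_unique (q := pt st w) (fc_divides ra) D2); first exact: (cofc_equator ra).
by rewrite -same_pt; exact: (cofc_equator ry).
Qed.

(** The equator [y z w] is drawn and separates [x] from the canonical face [a z w], so the faces of
    the drawing on the two sides of [z w] are distinct. *)
Lemma reroute_incident m0 : fc st a z w m0 ->
  [/\ ~ Z m0, comp Z (pt st x) <> comp Z m0,
     arc st z w `<=` closure (comp Z (pt st x)) &
     fc st a z w `<=` comp Z m0 /\ arc st z w `<=` closure (comp Z m0)].
Proof.
move=> fm0.
have [[ax ay az aw xy] [xz xw yz yw zw]] := sroles_neq r.
have ra : sroles st a x z w y by apply: roles_swap23; exact: roles_swap12.
have rx : sroles st x a z w y by exact: rolesC.
have F1 : fc st a z w `<=` ~` Z by apply: (fc_avoids (p' := x) ra); right.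
have F2 : fc st x z w `<=` ~` Z by apply: (fc_avoids (p' := a) rx); left.
have nZx : ~ Z (pt st x) := pole_not_drawn r.
have cx : fc st x z w `<=` comp Z (pt st x).
  apply: component_reach => //; have [_ _ _ [c _] [clF _]] := fc_divides rx => //.
  by apply: clF; left; left; exact: arc_l.
have ca : fc st a z w `<=` comp Z m0.
  have [_ _ _ [c _] _] := fc_divides ra.
  exact: connected_component_max.
have [_ c1 _] := arc_in_closure rx cx; have [_ c2 _] := arc_in_closure ra ca.
split=> //; [exact: F1|].
have eq : divides (tri st y z w) (side st x) (side st a).
  by apply: equator_sides; exact: rolesC r.
have T : tri st y z w `<=` Z by apply: tri_drawn; first [done|by rewrite eq_sym|by rewrite Esym].
have sx := divides_side eq T (side_pole (rolesC r)).
have sa := divides_side (dividesC eq) T (fc_side ra fm0).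
move=> e; have m0x : comp Z (pt st x) m0.
  by rewrite e; apply: connected_component_refl; exact: F1.
have m0a : comp Z m0 m0 by rewrite -e.
have [_ _ d _ _] := eq; have : (side st x `&` side st a) m0 by split; [exact: sx|exact: sa].
by rewrite d.
Qed.

Lemma set0F (U V : set plane) X : U `&` V = set0 -> U X -> V X -> False.
Proof. by move=> UV UX VX; have : (U `&` V) X by []; rewrite UV. Qed.

Lemma near_iff (P Q : plane -> Prop) X (A B : set plane) :
  nbhs X A -> nbhs X B -> (forall Y, A Y -> B Y -> (P Y <-> Q Y)) ->
  \forall Y \near X, P Y <-> Q Y.
Proof. by move=> nA nB H; apply: filterS2 nA nB. Qed.

Lemma reach2 : fc st2 x a z `<=` comp Z' (pt st2 x).
Proof.
have rx2 : sroles st2 x y a z w by exact: rolesC.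
apply: component_reach.
- by have [_ _ _ []] := fc_divides rx2.
- by apply: (fc_avoids (p' := y) rx2); left.
- by have [_ _ _ _ [clF _]] := fc_divides rx2; apply: clF; left; left; exact: arc_l.
- exact: (pole_not_drawn (rolesC rx2)).
Qed.

(* If [a z w] is a triangle of the graph, the edge [c] of [same_face] is [z a];
   otherwise, say when [a z] is not an edge, [c] is [z y]. *)
Lemma reroute_same_face_meridian m0 : fc st a z w m0 -> E a z -> E a w ->
  arc st z a `<=` closure (comp Z m0) /\
  exists m, [/\ arc st z a m, forall k, m <> pt st k &
    \forall Y \near m, comp Z m0 Y <-> comp Z' (pt st2 x) Y].
Proof.
move=> fm0 Eaz Eaw.
have [_ _ _ [ca _]] := reroute_incident fm0.
have [[ax ay az aw xy] [xz xw yz yw zw]] := sroles_neq r.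
have ra : sroles st a x z w y by apply: roles_swap23; exact: roles_swap12.
have rx2 : sroles st2 x y a z w by exact: rolesC.
have [c1 _ _] := arc_in_closure ra ca.
split; first by rewrite arcC.
have [m am nm] := arc_middle st az; exists m; split=> //; first by rewrite arcC.
have am2 : arc st2 a z m by have [_ _ -> _ _] := same_arcs.
have nm2 k : m <> pt st2 k by rewrite same_pt.
(* The arc [a z] is a meridian of [st], between the faces [a z w] and [a z y], and an equatorial arc
   of [st2], between [x a z] and [y a z]. By [common_face] the second faces of the two pairs
   coincide, so the first ones agree near [m]. *)
apply: (near_iff (near_meridian_arc ra am (nm a) (nm z))
  (near_equator_arc rx2 am2 (nm2 a) (nm2 z))) => Y A B.
have sub : comp Z m0 `<=` fc st a z w.
  apply: divides_side (fc_divides ra) _ fm0.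
  by apply: tri_drawn; first [done|by rewrite eq_sym|by rewrite Esym].
have sub2 : comp Z' (pt st2 x) `<=` side st2 x.
  apply: divides_side (equator_sides rx2) _ (side_pole rx2).
  by apply: tri_drawn; first [done|by rewrite eq_sym|by rewrite Esym].
have dis := fc_disjoint ra.
have F : fc st a z y = fc st2 y a z by rewrite common_face fc_swap.
have [_ _ disx _ _] := equator_sides rx2.
have npa : ~~ polar st a z.
  by apply: (equator_nonpolar r); rewrite !inE eqxx ?orbT.
have e2 : arc st2 a z = arc st a z by have [] := same_arcs.
split.
  move=> /sub fY; case: B => [[aY|/reach2//]|]; last by rewrite -F => /(set0F dis fY).
  by exfalso; apply: (fc_arc ra az npa fY); rewrite -e2.
move=> gY; case: A => [[aY|/ca//]|fY]; exfalso.
  apply: (connected_component_sub gY); apply: (arc_drawn ax _ az Eaz); first by rewrite eq_sym.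
  by rewrite e2.
rewrite F in fY; exact: (set0F disx (sub2 _ gY) (fc_side (rolesC rx2) fY)).
Qed.

Lemma reroute_same_face_equator m0 : fc st a z w m0 -> ~~ E a z ->
  arc st z y `<=` closure (comp Z m0) /\
  exists m, [/\ arc st z y m, forall k, m <> pt st k &
    \forall Y \near m, comp Z m0 Y <-> comp Z' (pt st2 x) Y].
Proof.
move=> fm0 nEaz.
have [nZm0 _ _ [ca _]] := reroute_incident fm0.
have [[ax ay az aw xy] [xz xw yz yw zw]] := sroles_neq r.
have ra : sroles st a x z w y by apply: roles_swap23; exact: roles_swap12.
have ra' : sroles st a x z y w by exact: roles_swap23.
have ry2 : sroles st2 y x z a w by exact: roles_swap12.
have rx2 : sroles st2 x y a z w by exact: rolesC.
have npa : ~~ polar st a z.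
  by apply: (equator_nonpolar r); rewrite !inE eqxx ?orbT.
have npa2 : ~~ polar st2 a z.
  by apply: (equator_nonpolar r2); rewrite !inE eqxx ?orbT.
have e2 : arc st2 a z = arc st a z by have [] := same_arcs.
have F := common_face.
(* An inner point of the undrawn arc [a z] is a passage: in [st] it joins the faces [a z w] and
   [a z y], in [st2] the faces [y z a] and [x a z]. So the face of [m0] and the face of [x] after
   the reroute both contain the common face. *)
have [m1 am1 nm1] := arc_middle st az.
have nZm1 : ~ Z m1.
  by apply: (middle_not_drawn az npa _ Esym nEaz am1 nm1) => k l; exact: sroles_polarE r.
have nZm1' : ~ Z' m1.
  have rx' : sroles st2 y x a z w := r2.
  apply: (middle_not_drawn az npa2 _ Esym nEaz); first by move=> k l; exact: sroles_polarE rx'.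
    by rewrite e2.
  by move=> k; rewrite same_pt.
have reach_m1 s p p' u v t : sroles s p p' u v t -> fc s p u v `<=` ~` drawn s x E ->
    ~ drawn s x E m1 -> tri s p u v m1 -> fc s p u v `<=` comp (drawn s x E) m1.
  move=> rs av nd tm; have [_ _ _ [c _] [clF _]] := fc_divides rs.
  by apply: component_reach => //; exact: clF.
have cF : fc st a z y `<=` comp Z m0.
  have H1 : fc st a z y `<=` comp Z m1.
    apply: (reach_m1 _ _ _ _ _ _ ra') => //; last by left; left.
    by apply: (fc_avoids (p' := x) ra'); right.
  have H2 : fc st a z w `<=` comp Z m1.
    apply: (reach_m1 _ _ _ _ _ _ ra) => //; last by left; left.
    by apply: (fc_avoids (p' := x) ra); right.
  by rewrite -(same_connected_component (H2 _ fm0)).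
have cF2 : fc st2 y z a `<=` comp Z' (pt st2 x).
  have H1 : fc st2 y z a `<=` comp Z' m1.
    apply: (reach_m1 _ _ _ _ _ _ ry2) => //; last by left; right; rewrite arcC e2.
    by apply: (fc_avoids (p' := x) ry2); right.
  have H2 : fc st2 x a z `<=` comp Z' m1.
    apply: (reach_m1 _ _ _ _ _ _ rx2) => //; last by left; right; rewrite e2.
    by apply: (fc_avoids (p' := y) rx2); left.
  have [X fX] : exists X, fc st2 x a z X.
    have [_ _ _ _ [clF _]] := fc_divides rx2.
    have [||X [fX _]] := clF (pt st2 x) _ setT; [by left; left; exact: arc_l|exact: filterT|].
    by exists X.
  have h1 := same_connected_component (H2 _ fX).
  have h2 := same_connected_component (reach2 fX).
  by rewrite h2 -h1.
have [_ cl _] := arc_in_closure ra' cF.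
split=> //.
have zy : z != y by rewrite eq_sym.
have [m am nm] := arc_middle st zy; exists m; split=> //.
have e3 : arc st2 y z = arc st y z by have [] := same_arcs.
have am2 : arc st2 y z m by rewrite e3 arcC.
have nm2 k : m <> pt st2 k by rewrite same_pt.
(* The arc [z y] is equatorial in [st] and a meridian of [st2]. On one side of it lies the common
   face; the other side is excluded by [subf] before the reroute and by [subg] after it. *)
apply: (near_iff (near_equator_arc ra' am (nm z) (nm y))
  (near_meridian_arc ry2 am2 (nm2 y) (nm2 z))) => Y A B.
have Ey : E z y by rewrite Esym.
have notarc : arc st z y Y -> Z Y /\ Z' Y.
  move=> aY; split.
    by apply: (arc_drawn _ _ zy Ey) => //; rewrite eq_sym.
  apply: (arc_drawn _ _ yz Eyz); [by rewrite eq_sym|by rewrite eq_sym|].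
  by rewrite e3 arcC.
have rx : sroles st x a z y w by exact: rolesC.
have eq := equator_sides rx.
have subf : comp Z m0 `<=` side st a.
  apply: divides_side (dividesC eq) _ (fc_side ra fm0).
  by apply: tri_drawn; first [done|by rewrite eq_sym|by rewrite Esym].
have ryw : sroles st2 y x z w a by apply: roles_swap23; exact: roles_swap12.
have subg : comp Z' (pt st2 x) `<=` cofc st2 y z w.
  apply: divides_side (dividesC (fc_divides ryw)) _ (cofc_pole ryw).
  by apply: tri_drawn; first [done|by rewrite eq_sym|by rewrite Esym].
have [_ _ dis _ _] := eq.
have [_ _ dis2 _ _] := fc_divides ryw.
split.
  move=> fY; have nZ := connected_component_sub fY.
  case: A => [[/notarc [/nZ//]|]|fx].
    by rewrite F => /cF2.
  by case: (set0F dis (fc_side rx fx) (subf _ fY)).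
move=> gY; have nZ := connected_component_sub gY.
case: B => [[aY|]|fx].
- by case: nZ; have [] := notarc _ => //; rewrite arcC -e3.
- by rewrite -F => /cF.
- by case: (set0F dis2 fx (subg _ gY)).
Qed.

End RerouteFaces.

(** * Stories *)

Section Drawings.
Variables (R : realType) (G : sgraph) (sl : G -> 'I_5).
Local Notation plane := (plane R).
Implicit Types (st : state R) (W : {set G}) (e c : {set G}) (u v : G) (i j k : 'I_5).

(** Edges are unordered, so the curve is a union over both orders of the ends; the two arcs are
    equal by [arcC]. *)
Definition drw st : drawing R G :=
  Drawing (fun v => pt st (sl v))
    (fun e => [set X | exists u v, [/\ u \in e, v \in e, u != v & arc st (sl u) (sl v) X]]).

Lemma drw_curve st u v : u != v -> curve (drw st) [set u; v]%SET = arc st (sl u) (sl v).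
Proof.
move=> uv; apply/seteqP; split=> X /=; last by move=> ?; exists u, v; rewrite !inE !eqxx orbT.
case=> u' [v' []]; rewrite !inE => /orP [] /eqP -> /orP [] /eqP ->; rewrite ?eqxx // => _.
by rewrite arcC.
Qed.

Lemma edge_neq u v : [set u; v]%SET \in edges G -> u != v.
Proof. by move=> /card_edge; rewrite cards2; case: eqP. Qed.

Lemma induced_edgeP W e : reflect (exists u v, [/\ u \in W, v \in W, u != v, e = [set u; v]%SET
  & [set u; v]%SET \in edges G]) (e \in induced_edges W).
Proof.
rewrite inE; apply: (iffP andP) => [[eE eW]|[u [v [uW vW uv -> uvE]]]]; last first.
  by split=> //; apply/fintype.subsetP => k; rewrite !inE => /orP [] /eqP ->.
have /cards2P [u [v [uv euv]]] : #|e| == 2%N by rewrite card_edge.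
exists u, v; subst e; split=> //; apply: (fintype.subsetP eW); by rewrite !inE eqxx ?orbT.
Qed.

Lemma set2_eq (T : finType) (i j k l : T) : i != j -> [set i; j]%SET = [set k; l]%SET ->
  (i = k /\ j = l) \/ (i = l /\ j = k).
Proof.
move=> ij e; have : (i \in [set k; l]%SET) && (j \in [set k; l]%SET).
  by rewrite -e !inE !eqxx orbT.
rewrite !inE => /andP [/orP [] /eqP ei /orP [] /eqP ej]; subst.
- by rewrite eqxx in ij.
- by left.
- by right.
- by rewrite eqxx in ij.
Qed.

Definition good st W := forall u v, u \in W -> v \in W -> [set u; v]%SET \in edges G ->
  ~~ polar st (sl u) (sl v).

Lemma drw_planar st W : {in W &, injective sl} -> good st W -> planar_drawing W (drw st).
Proof.
move=> sli gd.
have sln u v : u \in W -> v \in W -> u != v -> sl u != sl v.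
  by move=> uW vW; apply: contra => /eqP /(sli _ _ uW vW) ->.
split.
- by move=> u v uW vW /= /pt_inj; exact: sli.
- move=> u v uvE; have := uvE; rewrite inE => /andP [E sub].
  have uv := edge_neq E; rewrite (drw_curve st uv) /=; apply: arc_jordan.
  by apply: sln uv; apply: (fintype.subsetP sub); rewrite !inE eqxx ?orbT.
- move=> e k /induced_edgeP [u [v [uW vW uv -> _]]] kW.
  rewrite (drw_curve st uv) /= => /(arc_pt (sln _ _ uW vW uv)) [] /sli -> //;
  by rewrite !inE eqxx ?orbT.
- move=> e e' /induced_edgeP [u [v [uW vW uv -> E]]] /induced_edgeP [u' [v' [uW' vW' uv' -> E']]].
  move=> ne X; rewrite (drw_curve st uv) (drw_curve st uv') => a1 a2.
  have [|k [k1 k2 ->]] := arc_planar (sln _ _ uW vW uv) (sln _ _ uW' vW' uv')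
    (gd _ _ uW vW E) (gd _ _ uW' vW' E') _ a1 a2.
    apply: contra ne => /eqP /(set2_eq (sln _ _ uW' vW' uv')) [] [e1 e2].
      by rewrite (sli _ _ uW' uW e1) (sli _ _ vW' vW e2).
    by rewrite (sli _ _ uW' vW e1) (sli _ _ vW' uW e2) finset.setUC.
  have vx (b c : G) : k \in [:: sl b; sl c] -> exists2 d, d \in [set b; c]%SET & k = sl d.
    by rewrite !inE => /orP [] /eqP ->; [exists b|exists c]; rewrite // !inE eqxx ?orbT.
  have [d dW ed] := vx _ _ k1; have [d' dW' ed'] := vx _ _ k2.
  have inW (b c d0 : G) : b \in W -> c \in W -> d0 \in [set b; c]%SET -> d0 \in W.
    by move=> bW cW; rewrite !inE => /orP [] /eqP ->.
  have dd : d = d' by apply: sli; rewrite -?ed //; [exact: (inW u v)|exact: (inW u' v')].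
  by exists d; [rewrite {2}dd dW|rewrite ed].
Qed.

Definition slot_edge W i j : bool :=
  [exists u in W, exists v in W, [&& sl u == i, sl v == j & [set u; v]%SET \in edges G]].

Lemma slot_edgeP W i j : reflect (exists u v, [/\ u \in W, v \in W, sl u = i, sl v = j
  & [set u; v]%SET \in edges G]) (slot_edge W i j).
Proof.
apply: (iffP exists_inP) => [[u uW /exists_inP [v vW /and3P [/eqP ui /eqP vj E]]]|].
  by exists u, v.
case=> u [v [uW vW ui vj E]]; exists u => //; apply/exists_inP; exists v => //.
by rewrite ui vj !eqxx.
Qed.

Lemma slot_edge_sym W : symmetric (slot_edge W).
Proof.
have H i j : slot_edge W i j -> slot_edge W j i.
  move=> /slot_edgeP [u [v [uW vW ui vj E]]]; apply/slot_edgeP; exists v, u.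
  by rewrite finset.setUC.
by move=> i j; apply/idP/idP; exact: H.
Qed.

Lemma drawn_set_drw st W x : {in W &, injective sl} -> (forall v, v \in W -> sl v != x) ->
  (forall i, i != x -> exists2 v, v \in W & sl v = i) ->
  drawn_set W (drw st) = drawn st x (slot_edge W).
Proof.
move=> sli nx cover; apply/seteqP; split=> X.
  case=> [[v vW ->]|[e /induced_edgeP [u [v [uW vW uv -> E]]]]].
    by left; exists (sl v) => //; exact: nx.
  rewrite drw_curve // => aX; right; exists (sl u), (sl v); split=> //.
  - exact: nx.
  - exact: nx.
  - by apply: contra uv => /eqP /(sli _ _ uW vW) ->.
  - by apply/slot_edgeP; exists u, v.
case=> [[i ix ->]|[i [j [ix jx ij /slot_edgeP [u [v [uW vW ui vj E]]] aX]]]].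
  by have [v vW vi] := cover i ix; left; exists v; rewrite //= vi.
right; exists [set u; v]%SET.
  by apply/induced_edgeP; exists u, v; split=> //; exact: edge_neq.
by rewrite drw_curve ?edge_neq // ui vj.
Qed.

Lemma triangle_cycle W (u v k : G) : u != v -> v != k -> u != k -> [set u; v]%SET \in induced_edges W ->
  [set v; k]%SET \in induced_edges W -> [set k; u]%SET \in induced_edges W ->
  on_common_cycle W [set u; v]%SET [set v; k]%SET.
Proof.
move=> uv vk uk E1 E2 E3; exists [:: u; v; k]; split=> //.
- by rewrite /= !inE negb_or uv uk vk.
- by rewrite /= E1 E2 E3.
- by exists u; rewrite ?inE ?eqxx //= eqxx.
- by exists v; rewrite ?inE ?eqxx ?orbT //= eq_sym (negPf uv) eqxx.
Qed.

Lemma drw_same_face st st2 W m0 x vu vv vc (f' := connected_component (~` drawn_set W (drw st)) m0) :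
  vu != vv -> vv != vc -> vu != vc -> [set vu; vv]%SET \in induced_edges W ->
  [set vv; vc]%SET \in induced_edges W -> [set vc; vu]%SET \in induced_edges W ->
  arc st (sl vv) (sl vc) `<=` closure f' /\
  (exists m, [/\ arc st (sl vv) (sl vc) m, forall k, m <> pt st k &
    \forall Y \near m, f' Y <->
      connected_component (~` drawn_set W (drw st2)) (pt st2 x) Y]) ->
  same_face W (drw st) [set vu; vv]%SET f'
    (connected_component (~` drawn_set W (drw st2)) (pt st2 x)).
Proof.
move=> nuv nvc nuc E1 E2 E3 [cl [m [am nm nr]]]; exists [set vv; vc]%SET, m; split=> //.
- apply/negP => /eqP e; have : vu \in [set vv; vc]%SET by rewrite e !inE eqxx.
  by rewrite !inE (negPf nuv) (negPf nuc).
- exact: triangle_cycle.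
- by rewrite /incident drw_curve.
- by split; [rewrite drw_curve|move=> k _; exact: nm].
Qed.

Lemma drw_reroute st st2 W a x y z w : {in W &, injective sl} ->
  (forall v, v \in W -> sl v != x) -> (forall i, i != x -> exists2 v, v \in W & sl v = i) ->
  sroles st a x y z w -> sroles st2 y x a z w -> pt st2 =1 pt st ->
  (forall i j, i != j -> i != x -> j != x -> [set i; j]%SET != [set z; w]%SET ->
     arc st2 i j = arc st i j) ->
  slot_edge W y z -> slot_edge W y w -> slot_edge W z w ->
  exists e, reroute W (drw st) (drw st2) e (pt st x).
Proof.
move=> sli nx cover r r2 spt sarc Eyz Eyw Ezw.
have Esym := @slot_edge_sym W.
have [[ax ay az aw xy] [xz xw yz yw zw]] := sroles_neq r.
have [va vaW ea] := cover a ax.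
have [vy vyW ey] : exists2 v, v \in W & sl v = y by apply: cover; rewrite eq_sym.
have [vz vzW ez] : exists2 v, v \in W & sl v = z by apply: cover; rewrite eq_sym.
have [vw vwW ew] : exists2 v, v \in W & sl v = w by apply: cover; rewrite eq_sym.
have E u v : u \in W -> v \in W -> slot_edge W (sl u) (sl v) ->
    [set u; v]%SET \in induced_edges W.
  move=> uW vW /slot_edgeP [u' [v' [uW' vW' eu ev E]]].
  move: E; rewrite (sli _ _ uW' uW eu) (sli _ _ vW' vW ev) => E.
  by apply/induced_edgeP; exists u, v; split=> //; exact: edge_neq.
have vne u v : sl u != sl v -> u != v by apply: contra => /eqP ->.
have gd (s : state R) (p u v t : 'I_5) : sroles s p x u v t -> good s W.
  move=> rs b d bW dW _; apply/negP => /(sroles_polarE rs).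
  by rewrite ![x == _]eq_sym (negPf (nx _ bW)) (negPf (nx _ dW)).
have ds := drawn_set_drw st sli nx cover; have ds2 := drawn_set_drw st2 sli nx cover.
have [m0 fm0] : exists m0, fc st a z w m0.
  have ra : sroles st a x z w y by apply: roles_swap23; exact: roles_swap12.
  have [_ _ _ _ [clF _]] := fc_divides ra.
  have [||X [fX _]] := clF (pt st a) _ setT; [by left; left; exact: arc_l|exact: filterT|].
  by exists X.
have [nZ ff i1 [_ i2]] := reroute_incident r Esym Eyz Eyw Ezw fm0.
have vzw : vz != vw by apply: vne; rewrite ez ew.
exists [set vz; vw]%SET; split.
- by apply: E => //; rewrite ez ew.
- exact: drw_planar (gd _ _ _ _ _ r2).
- by move=> v vW /=; rewrite spt.
- move=> c /induced_edgeP [u [v [uW vW uv -> Euv]]] ne; rewrite !drw_curve //.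
  apply/esym/sarc; rewrite ?nx //; first by apply: contra uv => /eqP /(sli _ _ uW vW) ->.
  apply: contra ne => /eqP /set2_eq [|[e1 e2]|[e1 e2]].
  + by apply: contra uv => /eqP /(sli _ _ uW vW) ->.
  + by rewrite (sli _ _ uW vzW) ?e1 ?ez // (sli _ _ vW vwW) ?e2 ?ew.
  + by rewrite (sli _ _ uW vwW) ?e1 ?ew // (sli _ _ vW vzW) ?e2 ?ez // finset.setUC.
exists (connected_component (~` drawn_set W (drw st)) (pt st x)),
  (connected_component (~` drawn_set W (drw st)) m0),
  (connected_component (~` drawn_set W (drw st2)) (pt st2 x)).
have nZx : ~ drawn_set W (drw st) (pt st x) by rewrite ds; exact: pole_not_drawn r.
have nZ2 : ~ drawn_set W (drw st2) (pt st2 x) by rewrite ds2; exact: pole_not_drawn r2.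
have curve_zw : curve (drw st) [set vz; vw]%SET = arc st z w by rewrite drw_curve // ez ew.
split.
- by split; [exists (pt st x)|exists m0; rewrite ?ds|rewrite ds].
- by rewrite /incident curve_zw ds.
- exact: connected_component_refl.
- split; first by exists (pt st2 x).
  have [Eaz|nEaz] := boolP (slot_edge W a z).
    have [Eaw|nEaw] := boolP (slot_edge W a w).
      rewrite finset.setUC; apply: (@drw_same_face _ _ _ _ _ vw vz va).
      + by rewrite eq_sym.
      + by apply: vne; rewrite ez ea eq_sym.
      + by apply: vne; rewrite ew ea eq_sym.
      + by apply: E => //; rewrite ew ez Esym.
      + by apply: E => //; rewrite ez ea Esym.
      + by apply: E => //; rewrite ea ew.
      by rewrite ez ea ds ds2; apply: (reroute_same_face_meridian r r2 spt sarc Esym).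
    (* The absent edge is [a w] here: the lemma for an absent [a z] applies with [z] and [w]
       exchanged. *)
    apply: (@drw_same_face _ _ _ _ _ vz vw vy) => //.
    + by apply: vne; rewrite ew ey eq_sym.
    + by apply: vne; rewrite ez ey eq_sym.
    + by apply: E => //; rewrite ez ew.
    + by apply: E => //; rewrite ew ey Esym.
    + by apply: E => //; rewrite ey ez.
    have r' : sroles st a x y w z by exact: roles_swap23.
    have r2' : sroles st2 y x a w z by exact: roles_swap23.
    have sarc' i j : i != j -> i != x -> j != x -> [set i; j]%SET != [set w; z]%SET ->
        arc st2 i j = arc st i j by rewrite (finset.setUC [set w]%SET); exact: sarc.
    have Ewz : slot_edge W w z by rewrite Esym.
    have fm0' : fc st a w z m0 by rewrite fc_swap.
    by rewrite ew ey ds ds2; apply: (reroute_same_face_equator r' r2' spt sarc' Esym).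
  rewrite finset.setUC; apply: (@drw_same_face _ _ _ _ _ vw vz vy) => //.
  + by rewrite eq_sym.
  + by apply: vne; rewrite ez ey eq_sym.
  + by apply: vne; rewrite ew ey eq_sym.
  + by apply: E => //; rewrite ew ez Esym.
  + by apply: E => //; rewrite ez ey Esym.
  + by apply: E => //; rewrite ey ew.
  by rewrite ez ey ds ds2; apply: (reroute_same_face_equator r r2 spt sarc Esym).
- by rewrite -spt; exact: connected_component_refl.
Qed.

End Drawings.

(** * Flips of states in terms of roles *)

Section Steps.
Variable R : realType.
Implicit Types (st : state R) (i j k : 'I_5).

Lemma label_surj st l : (l < 5)%N -> exists i, label st i = l.
Proof.
move=> l5; pose f i : 'I_5 := Ordinal (label_lt st i).
have fi : injective f by move=> i j /(congr1 val) /= /label_inj.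
have [g _ gK] := injF_bij fi; exists (g (Ordinal l5)).
by have := congr1 val (gK (Ordinal l5)).
Qed.

Lemma polar_sroles st p p' u v t : polar st p p' ->
  uniq [:: p; p'; u; v; t] -> sroles st p p' u v t.
Proof.
rewrite -(map_inj_uniq (@label_inj _ st)) /polar /sroles /=.
move: (label_lt st p) (label_lt st p') (label_lt st u) (label_lt st v) (label_lt st t).
move: (label st p) (label st p') (label st u) (label st v) (label st t).
move=> a b c d e _ _ c5 d5 e5; rewrite !inE !xpair_eqE /roles.
case/orP=> /andP [/eqP -> /eqP ->]; move: c d e c5 d5 e5.
all: by move=> [|[|[|[|[|c]]]]] [|[|[|[|[|d]]]]] [|[|[|[|[|e]]]]].
Qed.

Lemma pole_roles st x : ~~ (0 < label st x < 4)%N -> exists a y z w, sroles st a x y z w.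
Proof.
move=> px; have x5 := label_lt st x.
have [a ea] := @label_surj st (4 - label st x) (leq_ltn_trans (leq_subr _ _) (isT : (4 < 5)%N)).
have [y ey] := @label_surj st 1 isT; have [z ez] := @label_surj st 2 isT.
have [w ew] := @label_surj st 3 isT; exists a, y, z, w.
rewrite /sroles ea ey ez ew.
by case: (label st x) px x5 => [|[|[|[|[|]]]]].
Qed.

Lemma polar_pair st p p' u v t i j : sroles st p p' u v t -> polar st i j ->
  [set i; j]%SET = [set p; p']%SET.
Proof.
move=> r; have := sroles_polar r; rewrite /polar !inE !xpair_eqE.
case/orP=> /andP [/eqP e1 /eqP e2] /orP [] /andP [/eqP e3 /eqP e4].
- by rewrite (@label_inj _ st i p) ?e1 // (@label_inj _ st j p') ?e2.
- by rewrite (@label_inj _ st j p) ?e1 // (@label_inj _ st i p') ?e2 // finset.setUC.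
- by rewrite (@label_inj _ st j p) ?e1 // (@label_inj _ st i p') ?e2 // finset.setUC.
- by rewrite (@label_inj _ st i p) ?e1 // (@label_inj _ st j p') ?e2.
Qed.

Lemma flip_roles st p p' u v t : sroles st p p' u v t ->
  exists st', [/\ pt st' =1 pt st, sroles st' u v p p' t &
    forall i j, i != j -> ~~ polar st i j -> [set i; j]%SET != [set u; v]%SET ->
      arc st' i j = arc st i j].
Proof.
move=> r; have [_ [_ _ uv _ _]] := sroles_neq r.
have [hu hv] : (0 < label st u < 4)%N /\ (0 < label st v < 4)%N.
  by move: r; rewrite /sroles /roles /= => /and5P [_ _ _ _ /and4P []].
have [st' [e pol a]] := flip uv hu hv; exists st'; split=> //.
apply: polar_sroles => //; have [[n1 n2 n3 n4 n5] [n6 n7 n8 n9 n10]] := sroles_neq r.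
by rewrite /= !inE !negb_or (eq_sym u p) (eq_sym u p') (eq_sym v p) (eq_sym v p') n1 n2 n3
  n4 n5 n6 n7 n8 n9 n10.
Qed.

(** The first flip removes [z w] and draws [a x]; its poles [z], [w] are joined again, along a new
    arc, by the second flip, which removes [x y]. Arcs at [x] may change since that position is
    free. *)
Lemma double_flip st a x y z w : sroles st a x y z w ->
  exists st2, [/\ pt st2 =1 pt st, sroles st2 y x a z w &
    forall i j, i != j -> i != x -> j != x -> [set i; j]%SET != [set z; w]%SET ->
     arc st2 i j = arc st i j].
Proof.
move=> r; have rz : sroles st a x z w y by apply: roles_swap23; exact: roles_swap12.
have [st1 [e1 r1 a1]] := flip_roles rz.
have r1' : sroles st1 z w y x a.
  by apply: roles_swap12; apply: roles_swap23; apply: roles_swap12.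
have [st2 [e2 r2 a2]] := flip_roles r1'.
exists st2; split.
- by move=> i; rewrite e2 e1.
- by apply: roles_swap12; apply: roles_swap23.
move=> i j ij ix jx nzw; rewrite a2 // ?a1 //.
- apply/negP => /(polar_pair r) /(set2_eq ij) [] [] ei ej; first by rewrite ej eqxx in jx.
  by rewrite ei eqxx in ix.
- by apply: contra nzw => /(polar_pair r1) ->.
apply: contra ix => /eqP /(set2_eq ij) [] [ei ej] //; last by rewrite ei.
by rewrite ej eqxx in jx.
Qed.
End Steps.

(** * One step of a story *)

Section Step.
Variables (R : realType) (G : sgraph) (sl : G -> 'I_5).
Implicit Types (st : state R) (W : {set G}) (u v : G) (i j k : 'I_5).

Lemma good_roles st p p' b c d W : sroles st p p' b c d ->
  ~~ slot_edge sl W p p' -> good sl st W.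
Proof.
move=> r nE u v uW vW E; apply: contra nE => pol.
have := polar_pair r pol; case/set2_eq => [|[<- <-]|[<- <-]].
- apply/negP => /eqP e; have [[n _ _ _ _] _] := sroles_neq r; move: pol n.
  rewrite e /polar !inE !xpair_eqE; by lia.
- by apply/slot_edgeP; exists u, v.
- by apply/slot_edgeP; exists v, u; rewrite finset.setUC.
Qed.

Lemma same_drw st st' W : {in W &, injective sl} -> pt st' =1 pt st ->
  (forall i j, i != j -> slot_edge sl W i j -> arc st' i j = arc st i j) ->
  same_drawing W (drw sl st) (drw sl st').
Proof.
move=> sli spt sarc; split=> [v _ /=|e]; first by rewrite spt.
case/induced_edgeP => u [v [uW vW uv -> E]]; rewrite !drw_curve // sarc //.
  by apply: contra uv => /eqP /(sli _ _ uW vW) ->.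
by apply/slot_edgeP; exists u, v.
Qed.

Variables (Wn : {set G}) (vn : G).
Hypothesis sli : {in Wn &, injective sl}.
Hypothesis cover : forall i, exists2 v, v \in Wn & sl v = i.
Hypothesis vnW : vn \in Wn.
Let x := sl vn.
Let W := (Wn :\ vn)%SET.

Lemma old_window_inj : {in W &, injective sl}.
Proof. by move=> u v; rewrite !inE => /andP [_ uW] /andP [_ vW]; exact: sli. Qed.

Lemma old_window_slot v : v \in W -> sl v != x.
Proof. by rewrite !inE => /andP [vvn vW]; apply: contra vvn => /eqP /(sli vW vnW) ->. Qed.

Lemma old_window_cover i : i != x -> exists2 v, v \in W & sl v = i.
Proof.
move=> ix; have [v vW e] := cover i; exists v => //; rewrite !inE vW andbT.
by apply: contra ix => /eqP vE; rewrite -e vE.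
Qed.

Lemma old_window_edge i j : i != x -> j != x -> slot_edge sl Wn i j -> slot_edge sl W i j.
Proof.
move=> ix jx /slot_edgeP [u [v [uW vW ui vj E]]]; apply/slot_edgeP; exists u, v; split=> //.
  by rewrite !inE uW andbT; apply: contra ix => /eqP vE; rewrite -ui vE.
by rewrite !inE vW andbT; apply: contra jx => /eqP vE; rewrite -vj vE.
Qed.

Lemma old_window_edge_slot i j : slot_edge sl W i j -> i != x /\ j != x.
Proof. by move=> /slot_edgeP [u [v [/old_window_slot ui /old_window_slot vj <- <- _]]]. Qed.

Lemma old_window_subedge i j : slot_edge sl W i j -> slot_edge sl Wn i j.
Proof.
move=> /slot_edgeP [u [v [uW vW ui vj E]]]; apply/slot_edgeP; exists u, v; split=> //.
  by move: uW; rewrite !inE => /andP [].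
by move: vW; rewrite !inE => /andP [].
Qed.

Definition next_state st := exists st', [/\ pt st' =1 pt st, good sl st' Wn &
  exists es, [/\ uniq es, (size es <= 1)%N & forall P : set (plane R),
    (forall i, P (pt st i)) -> reroutes W P es (drw sl st) (drw sl st')]].

Lemma next_state_same st : good sl st Wn -> next_state st.
Proof.
move=> gd; exists st; split=> //; by exists [::].
Qed.

(** The arc gained, [a x], ends at the new vertex and the arc lost, [b c], is not an edge; so the
    common subgraph keeps its drawing and nothing is rerouted. *)
Lemma next_state_flip st a b c d : sroles st a x b c d -> ~~ slot_edge sl Wn b c -> next_state st.
Proof.
move=> r nE; have [st' [e r' arcs]] := flip_roles r; exists st'; split=> //.
  exact: good_roles r' nE.
exists [::]; split=> // P _; apply: same_drw => // [|i j ij Eij]; first exact: old_window_inj.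
have [ix jx] := old_window_edge_slot Eij; apply: arcs => //.
  by apply/negP => /(sroles_polarE r); rewrite ![x == _]eq_sym (negPf ix) (negPf jx).
apply: contra nE => /eqP /(set2_eq ij) [] [<- <-]; first exact: old_window_subedge.
by rewrite slot_edge_sym; exact: old_window_subedge.
Qed.

Definition full st a y z w := [/\ sroles st a x y z w, slot_edge sl Wn y z, slot_edge sl Wn y w
  & slot_edge sl Wn z w].

Lemma reroute_step st a y z w : full st a y z w ->
  exists st2 e, [/\ pt st2 =1 pt st, sroles st2 y x a z w
    & reroute W (drw sl st) (drw sl st2) e (pt st x)].
Proof.
case=> r Eyz Eyw Ezw; have [st2 [e r2 arcs]] := double_flip r.
have [[_ _ _ _ xy] [xz xw _ _ _]] := sroles_neq r.
have [yx zx wx] : [/\ y != x, z != x & w != x] by rewrite !(eq_sym _ x).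
have [f rer] := drw_reroute old_window_inj old_window_slot old_window_cover r r2 e arcs
  (old_window_edge yx zx Eyz) (old_window_edge yx wx Eyw) (old_window_edge zx wx Ezw).
by exists st2, f.
Qed.

Lemma next_state_reroute st a y z w : full st a y z w -> ~~ slot_edge sl Wn y x -> next_state st.
Proof.
move=> H nE; have [st2 [e [e2 r2 rer]]] := reroute_step H.
exists st2; split=> //; first exact: good_roles r2 nE.
exists [:: e]; split=> // P HP; by exists (drw sl st2), (pt st x).
Qed.

(** After the reroute the poles are [y] and [x], which may be adjacent. The flip at the nonedge
    [a z] then costs nothing, as the arc it gains ends at [x]. *)
Lemma next_state_reroute_flip st a y z w : full st a y z w -> ~~ slot_edge sl Wn a z ->
  next_state st.
Proof.
move=> H nE; have [st2 [e [e2 r2 rer]]] := reroute_step H.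
have [st3 [e3 r3 arcs]] := flip_roles r2.
exists st3; split; [by move=> i; rewrite e3 e2|exact: good_roles r3 nE|].
exists [:: e]; split=> // P HP; exists (drw sl st2), (pt st x); split=> //.
apply: same_drw => // [|i j ij Eij]; first exact: old_window_inj.
have [ix jx] := old_window_edge_slot Eij; apply: arcs => //.
  by apply/negP => /(sroles_polarE r2); rewrite ![x == _]eq_sym (negPf ix) (negPf jx).
apply: contra nE => /eqP /(set2_eq ij) [] [<- <-]; first exact: old_window_subedge.
by rewrite slot_edge_sym; exact: old_window_subedge.
Qed.

Lemma next_stateP st : good sl st W ->
  (exists u v, [/\ u \in Wn, v \in Wn, u != v & [set u; v]%SET \notin edges G]) ->
  next_state st.
Proof.
move=> gd [u0 [v0 [u0W v0W uv0 nE0]]].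
have nE : ~~ slot_edge sl Wn (sl u0) (sl v0).
  apply/negP => /slot_edgeP [u [v [uW vW /(sli uW u0W) eu /(sli vW v0W) ev E]]].
  by rewrite eu ev (negPf nE0) in E.
have ij : sl u0 != sl v0 by apply: contra uv0 => /eqP /(sli u0W v0W) ->.
move: (sl u0) (sl v0) ij nE => i j ij nE {u0 v0 u0W v0W uv0 nE0}.
(* If [x] is on the equator, both poles carry old vertices, which are not adjacent by [gd], and the
   state can be kept. *)
have [px|px] := boolP (0 < label st x < 4)%N.
  apply: next_state_same => u v uW vW E; apply/negP => pol.
  have nx b : polar st (sl u) (sl v) -> b = u \/ b = v -> b != vn.
    move=> + H; case: H => ->; rewrite /polar !inE !xpair_eqE => H; apply/negP => /eqP e; move: H px;
      rewrite /x e; lia.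
  have := gd u v; rewrite !inE uW vW (nx u) ?(nx v) //; [|by right|by left].
  by move=> /(_ isT isT E); rewrite pol.
have [a [y [z [w r]]]] := pole_roles px.
have sym b c := @slot_edge_sym G sl Wn b c.
have [Eax|nEax] := boolP (slot_edge sl Wn a x); last first.
  by apply: next_state_same; exact: good_roles r nEax.
have r1 : sroles st a x y w z by exact: roles_swap23.
have r2 : sroles st a x z w y by apply: roles_swap23; exact: roles_swap12.
have r2' : sroles st a x z y w by exact: roles_swap12.
have r3 : sroles st a x w z y by exact: roles_swap12.
have r3' : sroles st a x w y z by apply: roles_swap12; exact: roles_swap23.
have [Eyz|nEyz] := boolP (slot_edge sl Wn y z); last exact: next_state_flip r nEyz.
have [Eyw|nEyw] := boolP (slot_edge sl Wn y w); last exact: next_state_flip r1 nEyw.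
have [Ezw|nEzw] := boolP (slot_edge sl Wn z w); last exact: next_state_flip r2 nEzw.
have f1 : full st a y z w by [].
have f2 : full st a z y w by split=> //; rewrite sym.
have f3 : full st a w y z by split; rewrite 1?sym // sym.
have f1' : full st a y w z by split=> //; rewrite sym.
have all5 k : k \in [:: a; x; y; z; w].
  rewrite -(mem_map (@label_inj _ st)) /=; move: (label st k) (label_lt st k) => l l5.
  move: r; rewrite /sroles.
  move: (label st a) (label st x) (label st y) (label st z) (label st w).
  by apply: roles_ind; case: l l5 => [|[|[|[|[|]]]]].
have no b c : slot_edge sl Wn b c -> ~~ slot_edge sl Wn b c -> next_state st.
  by move=> ->.
(* With [a x] and the equator present, a nonadjacent pair consists of a pole and an equatorial
   position; the latter takes the part of [z] if the pole is [a], and that of [y] if it is [x]. *)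
have go b c : c \in [:: a; x; y; z; w] -> b \in [:: a; x] -> b != c -> ~~ slot_edge sl Wn b c ->
    next_state st.
  rewrite !inE => + /orP [] /eqP ->.
    case/or4P => [/eqP ->|/eqP ->|/eqP ->|/orP [] /eqP ->]; first by rewrite eqxx.
    - by move=> _; exact: no.
    - by move=> _; exact: next_state_reroute_flip f2.
    - by move=> _; exact: next_state_reroute_flip f1.
    - by move=> _; exact: next_state_reroute_flip f1'.
  rewrite sym; case/or4P => [/eqP ->|/eqP ->|/eqP ->|/orP [] /eqP ->].
  - by move=> _; exact: no.
  - by rewrite eqxx.
  - by move=> _; exact: next_state_reroute f1.
  - by move=> _; exact: next_state_reroute f2.
  - by move=> _; exact: next_state_reroute f3.
have [bi|ni] := boolP (i \in [:: a; x]); first exact: go (all5 j) bi ij nE.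
have [bj|nj] := boolP (j \in [:: a; x]).
  by apply: go (all5 i) bj _ _; rewrite 1?eq_sym 1?sym.
have eqv k : k \notin [:: a; x] -> k \in [:: y; z; w].
  by rewrite !inE negb_or => /andP [na nx]; have := all5 k; rewrite !inE (negPf na) (negPf nx).
move: (eqv _ ni) (eqv _ nj) ij nE; rewrite !inE.
case/or3P => /eqP ->; case/or3P => /eqP ->; rewrite ?eqxx // => _.
- exact: no.
- exact: no.
- by rewrite sym; exact: no.
- exact: no.
- by rewrite sym; exact: no.
- by rewrite sym; exact: no.
Qed.

End Step.

(** * Whole stories *)

Section Story.
Variables (R : realType) (S : graph_story).
Hypotheses (minS : minimal_story S) (w5 : story_window S = 5%N).
Let G := story_graph S.
Let tau : seq G := story_order S.
Implicit Types (u v : G) (i j : nat).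

Definition slot v : 'I_5 := inord (index v tau %% 5).

Lemma size_order : size tau = #|G|.
Proof.
rewrite -(card_uniqP (story_order_uniq S)); apply: eq_card => v.
by rewrite inE; exact: (story_order_total v).
Qed.

Lemma index_lt v : (index v tau < #|G|)%N.
Proof. by rewrite -size_order index_mem; exact: story_order_total. Qed.

Lemma order_le5 : (5 <= #|G|)%N.
Proof. by rewrite -w5; exact: story_window_le. Qed.

Lemma order_index_inj : injective (fun v => index v tau).
Proof. by move=> u v; apply: (index_inj u); exact: story_order_total. Qed.

Lemma visibleE i v : (v \in visible S i) = (index v tau < i <= index v tau + 5)%N.
Proof. by rewrite inE /position w5 addSn ltnS. Qed.

Lemma slot_inj i : {in visible S i &, injective slot}.
Proof.
move=> u v; rewrite !visibleE => hu hv /(congr1 val); rewrite /= !inordK ?ltn_pmod // => e.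
by apply: order_index_inj; lia.
Qed.

Lemma slot_cover i k : (5 <= i <= #|G|)%N -> exists2 v, v \in visible S i & slot v = k.
Proof.
move=> /andP [i5 iG]; have k5 := ltn_ord k.
(* The largest number below [i] congruent to [k] modulo 5; as [i] is at least 5, the subtraction
   does not truncate. *)
pose m := (if k < i %% 5 then (i %/ 5) * 5 + k else ((i %/ 5) - 1) * 5 + k)%N.
have [m1 m2] : (m < i <= m + 5)%N /\ (m %% 5 = k)%N by rewrite /m; case: ifP; lia.
have [v ev] : exists v, index v tau = m.
  have /card_gt0P [v0 _] : (0 < #|G|)%N by apply: leq_trans iG; lia.
  exists (nth v0 tau m); apply: index_uniq; last exact: story_order_uniq.
  by rewrite size_order; lia.
exists v; first by rewrite visibleE ev.
by apply: val_inj; rewrite /= inordK ?ltn_pmod // ev.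
Qed.

Lemma visible_le5 i : (i <= 5)%N -> visible S i \subset visible S 5.
Proof. by move=> i5; apply/fintype.subsetP => v; rewrite !visibleE; lia. Qed.

Lemma visible_step i : (5 <= i < #|G|)%N -> exists2 v, v \in visible S i.+1 &
  (visible S i :&: visible S i.+1 = visible S i.+1 :\ v)%SET.
Proof.
move=> /andP [i5 iG].
have [v ev] : exists v, index v tau = i.
  have /card_gt0P [v0 _] : (0 < #|G|)%N by apply: leq_trans iG.
  exists (nth v0 tau i); apply: index_uniq; last exact: story_order_uniq.
  by rewrite size_order.
exists v; first by rewrite visibleE ev; lia.
apply/setP => u; rewrite finset.in_setI in_setD1 !visibleE.
rewrite -(inj_eq order_index_inj) /= ev; move: (index u tau) => m.
lia.
Qed.

Lemma visible_nonadjacent i : ~ has_complete_subgraph 5 G -> (5 <= i <= #|G|)%N ->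
  exists u v, [/\ u \in visible S i, v \in visible S i, u != v & [set u; v]%SET \notin edges G].
Proof.
move=> nK hi; apply: contrapT => nE; apply: nK.
have H k : exists v, v \in visible S i /\ slot v = k.
  by have [v] := slot_cover k hi; exists v.
have [f Hf] := choice H.
have fi : injective f.
  by move=> j k e; have [_ <-] := Hf j; have [_ <-] := Hf k; rewrite e.
exists f; split=> // j k jk; apply/negPn/negP => E; apply: nE; exists (f j), (f k).
by have [? _] := Hf j; have [? _] := Hf k; split=> //; rewrite (inj_eq fi).
Qed.

(** The canonical drawing itself, labelled so that the nonadjacent positions [i], [j] become the
    poles 0 and 4. *)
Lemma initial_state (i j : 'I_5) : i != j -> exists st : state R, forall k l,
  polar st k l -> (k = i /\ l = j) \/ (k = j /\ l = i).
Proof.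
move=> ij; pose p := (tperm i ord0 * tperm (tperm i ord0 j) ord_max)%g.
have j0 : tperm i ord0 j != ord0.
  by rewrite -{2}(tpermL i ord0) (inj_eq perm_inj) eq_sym.
have pi : p i = ord0 by rewrite permM tpermL tpermD.
have pj : p j = ord_max by rewrite permM tpermL.
have lab_inj : injective (fun k => p k : nat) by move=> k l /val_inj /perm_inj.
exists (@State R (homeo_id R) (fun k => p k : nat) (fun k => ltn_ord (p k)) lab_inj) => k l.
have pE (a b : 'I_5) : p a = b :> nat -> forall c, p c = b -> a = c.
  by move=> pa c pc; apply: (@perm_inj _ p); rewrite pc; apply: val_inj.
rewrite /polar !inE !xpair_eqE /= => /orP [] /andP [/eqP ek /eqP el].
  by left; split; [exact: (pE k ord0 ek)|exact: (pE l ord_max el)].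
by right; split; [exact: (pE k ord_max ek)|exact: (pE l ord0 el)].
Qed.

(** The sequence starts at 5, where the window is full for the first time. The clause on [pt] keeps
    the five points fixed, so one [P] serves all steps. *)
Lemma story_states : ~ has_complete_subgraph 5 G -> forall m, (5 <= m <= #|G|)%N ->
  exists F : nat -> state R,
    (forall i, (5 <= i <= m)%N -> good slot (F i) (visible S i) /\ pt (F i) =1 pt (F 5)) /\
    (forall i, (5 <= i < m)%N -> exists es, [/\ uniq es, (size es <= 1)%N &
       forall P : set (plane R), (forall k, P (pt (F 5) k)) ->
         reroutes (visible S i :&: visible S i.+1)%SET P es
           (drw slot (F i)) (drw slot (F i.+1))]).
Proof.
move=> nK; elim=> [//|m IH] /andP [m5 mG].
have [m4|m5'] := leqP m 4.
  have {m5 mG IH} {}m4 : m = 4%N by lia.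
  have h5 : (5 <= 5 <= #|G|)%N by rewrite order_le5.
  have [u [v [uW vW uv nE]]] := visible_nonadjacent nK h5.
  have suv : slot u != slot v by apply: contra uv => /eqP /(slot_inj uW vW) ->.
  have [st Hst] := initial_state suv; exists (fun=> st).
  rewrite m4; split=> i hi; last by move: hi; lia.
  have -> : i = 5%N by lia.
  split=> // b c bW cW E; apply/negP => /Hst [] [eb ec].
    by move: nE; rewrite -(slot_inj bW uW eb) -(slot_inj cW vW ec) E.
  by move: nE; rewrite -(slot_inj bW vW eb) -(slot_inj cW uW ec) finset.setUC E.
have [|F [F1 F2]] := IH; first by rewrite m5' ltnW.
have mr : (5 <= m < #|G|)%N by rewrite m5'.
have [vn vnW eW] := visible_step mr.
have [gm ptm] := F1 m (introT andP (conj m5' (leqnn m))).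
have m1r : (5 <= m.+1 <= #|G|)%N by rewrite m5.
have := @next_stateP R G slot (visible S m.+1) vn (@slot_inj m.+1)
  (fun k => slot_cover k m1r) vnW (F m) _ (visible_nonadjacent nK m1r).
case.
  by rewrite -eW => u v; rewrite !finset.in_setI => /andP [uW _] /andP [vW _]; exact: gm.
move=> st [spt gst [es [ues ses res]]].
exists (fun i => if (i <= m)%N then F i else st); split=> [i /andP [i5 im]|i /andP [i5 im]].
  rewrite m5'; case: leqP => mi; first by apply: F1; rewrite i5.
  have -> : i = m.+1 by lia.
  by split=> // k; rewrite spt ptm.
rewrite m5'; have [im'|im'] := leqP i.+1 m.
  by rewrite (ltnW im'); apply: F2; rewrite i5.
have -> : i = m by lia.
rewrite leqnn; exists es; split=> // P HP; rewrite eW; apply: res => k.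
by rewrite ptm.
Qed.

Lemma story_realizable : ~ has_complete_subgraph 5 G -> reroute_realizable R 1 S.
Proof.
move=> nK; have [|F [F1 F2]] := story_states nK (m := #|G|); first by rewrite order_le5 leqnn.
(* Before time 5 the windows are nested, so parts of the fifth drawing serve for all of them without
   a reroute. *)
exists (range (pt (F 5%N))), (fun i => drw slot (F (maxn i 5))); split; last split.
- rewrite w5 (minS : story_extra S = 0%N) addn0; apply: (card_eq_trans (B := [set: 'I_5])); last exact/card_esym/card_II.
  by apply: inj_card_eq => k l _ _; exact: pt_inj.
- move=> i /andP [i0 iG].
  have hi : (5 <= maxn i 5 <= #|G|)%N by rewrite leq_maxr geq_max iG order_le5.
  have [gi pti] := F1 _ hi; split=> [|v _]; last by rewrite /= pti; exists (slot v).
  have sub : visible S i \subset visible S (maxn i 5).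
    by have [i5|//] := leqP i 5; exact: visible_le5.
  apply: drw_planar; first exact: slot_inj.
  by move=> u v uW vW; apply: gi; exact: (fintype.subsetP sub).
- move=> i /andP [i2 iG]; have [i5|i5] := leqP i 5.
    by exists [::]; rewrite (maxn_idPr (_ : i.-1 <= 5)%N) //; lia.
  have hi : (5 <= i.-1 < #|G|)%N by rewrite -/G in iG; lia.
  have [es [ues ses res]] := F2 _ hi; exists es; split=> //.
  have e : i = i.-1.+1 by lia.
  rewrite (maxn_idPl (_ : 5 <= i.-1)%N); last by lia.
  rewrite {2 4}e; apply: res => k; by exists k.
Qed.

Lemma complete_not_realizable : has_complete_subgraph 5 G -> ~ reroute_realizable R 1 S.
Proof.
case=> f [fi fE] [P [D [_ [Hpl _]]]].
(* The last vertex of the clique is adjacent to the other four, so all five lie in the window at its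
   position, which is [m.+1] because [index] counts from 0. *)
pose m := (\max_(j < 5) index (f j) tau)%N.
have [j0 ej0] : exists j : 'I_5, index (f j) tau = m.
  have [|j e] := @bigop.eq_bigmax 'I_5 (fun j : 'I_5 => index (f j) tau); first by rewrite card_ord.
  by exists j; rewrite -e.
have near (j : 'I_5) : (m < index (f j) tau + 5)%N.
  have [->|jj] := eqVneq j j0; first by rewrite ej0; lia.
  have j0j : j0 != j by rewrite eq_sym.
  have h : ((index (f j0) tau).+1 < (index (f j) tau).+1 + 5)%N.
    by have := story_edge_short (fE _ _ j0j); rewrite w5.
  by move: h; rewrite ej0; lia.
have le (j : 'I_5) : (index (f j) tau <= m)%N by exact: (leq_bigmax (F := fun j : 'I_5 => index (f j) tau)).
have vis (j : 'I_5) : f j \in visible S m.+1.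
  by rewrite visibleE; have := near j; have := le j; lia.
have [|[inj arcs _ cross] _] := Hpl m.+1; first by rewrite /= -ej0 -/G index_lt.
have ind (i j : 'I_5) : i != j -> [set f i; f j]%SET \in induced_edges (visible S m.+1).
  move=> ij; rewrite inE fE //=; apply/fintype.subsetP => v.
  by move=> /set2P [] ->; exact: vis.
have H (q : 'I_5 * 'I_5) : exists g : R -> plane R, q.1 != q.2 ->
    [/\ {within `[0, 1], continuous g}, g 0 = place (D m.+1) (f q.1),
       g 1 = place (D m.+1) (f q.2) & curve (D m.+1) [set f q.1; f q.2]%SET = g @` `[0, 1]].
  have [e|ne] := eqVneq q.1 q.2; first by exists (fun=> 0).
  by have [g [? _ ? ? ?]] := arcs _ _ (ind _ _ ne); exists g.
have [g Hg] := choice H.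
apply: (@complete5_not_planar R (fun j : 'I_5 => place (D m.+1) (f j))
  (fun i j : 'I_5 => g (i, j))).
- by move=> i j /inj e; apply/fi/e; exact: vis.
- by move=> i j ij; have [] := Hg (i, j) ij.
move=> i j k l s t uq s01 t01 e.
have [ij kl] : i != j /\ k != l.
  by move: uq; rewrite /= !inE !negb_or => /and4P [/and3P [? _ _] _ ? _].
have [_ _ _ c1] := Hg (i, j) ij; have [_ _ _ c2] := Hg (k, l) kl.
have [|||||w w1 _] := cross [set f i; f j]%SET [set f k; f l]%SET _ _ _ (g (i, j) s).
- exact: ind.
- exact: ind.
- apply/negP => /eqP E; have : f i \in [set f k; f l]%SET by rewrite -E !inE eqxx.
  rewrite !inE !(inj_eq fi); move: uq; rewrite /= !inE !negb_or.
  by case/and4P=> /and3P [_ /negPf -> /negPf ->].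
- by rewrite c1; exists s; rewrite //= in_itv.
- by rewrite c2 e; exists t; rewrite //= in_itv.
move: w1 uq; rewrite !inE /= => /andP [/orP [] /eqP -> /orP [] /eqP /fi ->];
  by rewrite ?inE ?eqxx ?orbT ?andbF.
Qed.

End Story.

Local Close Scope classical_set_scope.
Local Close Scope ring_scope.

Theorem theorem4 (R : realType) (S : graph_story)
    (minS : minimal_story S) (w5 : story_window S = 5) :
  reroute_realizable R 1 S <-> ~ has_complete_subgraph 5 (story_graph S).
Proof.
split=> [H K|]; last exact: story_realizable.
exact: (complete_not_realizable w5 K H).
Qed.
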